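(* Let $k\ge 1$ be an integer and let $\alpha\ge\beta\ge 0$. Let ${\bf P}_k^{(\alpha,\beta)}$ be the orthonormal Jacobi polynomial of degree $k$ and put $$ \delta_{\pm 1}=\frac{\beta^2-\alpha^2 \pm \sqrt{(2k+1)(2k+2\alpha+1)(2k+2\beta+1)(2k+2\alpha+2\beta+1)}}{(2k+\alpha+\beta+1)^2}, $$ $$ Z_k^{\alpha,\beta}(x)=\sqrt{\sqrt{(x-\delta_{-1})(\delta_1-x)}\,(1-x)^{\alpha}(1+x)^{\beta}}\;{\bf P}_k^{(\alpha,\beta)}(x),\qquad x\in[\delta_{-1},\delta_1]. $$ Then $$ \max_{x\in[\delta_{-1},\delta_1]}|Z_k^{\alpha,\beta}(x)|<5^{-1/4}\sqrt{3}. $$ Equivalently, $\max_{x\in[\delta_{-1},\delta_1]}\sqrt{(x-\delta_{-1})(\delta_1-x)}\,(1-x)^{\alpha}(1+x)^{\beta}\big({\bf P}_k^{(\alpha,\beta)}(x)\big)^2<\frac{3\sqrt5}{5}$.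
   Context: $P_k^{(\alpha,\beta)}$ denotes the Jacobi polynomial of degree $k$ in the standard (Szegő) normalization, orthogonal on $[-1,1]$ with respect to the weight $(1-x)^\alpha(1+x)^\beta$; its squared norm is ${\bf h}_k^2=\frac{2^{\alpha+\beta+1}\Gamma(k+\alpha+1)\Gamma(k+\beta+1)}{(2k+\alpha+\beta+1)\,k!\,\Gamma(k+\alpha+\beta+1)}$. The orthonormal Jacobi polynomial is ${\bf P}_k^{(\alpha,\beta)}=P_k^{(\alpha,\beta)}/{\bf h}_k$. One has $-1\le\delta_{-1}<\delta_1\le 1$. *)

(* Defs.v *)
From mathcomp Require Import all_boot all_order all_algebra.
From mathcomp Require Import all_classical all_reals all_analysis.
Set Implicit Arguments. Unset Strict Implicit. Unset Printing Implicit Defensive.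
Import Order.TTheory GRing.Theory Num.Theory.
Import numFieldNormedType.Exports.
Local Open Scope ring_scope.

Definition gbinom {R : realType} (a : R) (m : nat) : R :=
  (\prod_(i < m) (a - i%:R)) / (m`!)%:R.

(* Jacobi polynomial in Szego normalization (DLMF 18.5.8):
   P_n^{(al,be)}(x) = sum_{s=0}^n binom(n+al, n-s) binom(n+be, s)
                        ((x-1)/2)^s ((x+1)/2)^(n-s) *)
Definition jacobiP {R : realType} (n : nat) (al be x : R) : R :=
  \sum_(s < n.+1) gbinom (n%:R + al) (n - s) * gbinom (n%:R + be) s
                  * ((x - 1) / 2) ^+ s * ((x + 1) / 2) ^+ (n - s).

Definition jacobi_weight {R : realType} (al be x : R) : R :=
  (1 - x) `^ al * (1 + x) `^ be.

Definition jacobi_sqnorm {R : realType} (k : nat) (al be : R) : R :=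
  Rintegral (@lebesgue_measure R) `[-1, 1]%classic
    (fun x => jacobi_weight al be x * (jacobiP k al be x) ^+ 2).

Definition jacobiPn {R : realType} (k : nat) (al be x : R) : R :=
  jacobiP k al be x / Num.sqrt (jacobi_sqnorm k al be).

Definition delta_pm {R : realType} (sgn : bool) (k : nat) (al be : R) : R :=
  let S := Num.sqrt ((2 * k%:R + 1) * (2 * k%:R + 2 * al + 1)
                     * (2 * k%:R + 2 * be + 1) * (2 * k%:R + 2 * al + 2 * be + 1)) in
  (be ^+ 2 - al ^+ 2 + (if sgn then S else - S)) / (2 * k%:R + al + be + 1) ^+ 2.

Definition delta_p1 {R : realType} (k : nat) (al be : R) : R := delta_pm true k al be.
Definition delta_m1 {R : realType} (k : nat) (al be : R) : R := delta_pm false k al be.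

Definition Zfun {R : realType} (k : nat) (al be x : R) : R :=
  Num.sqrt (Num.sqrt ((x - delta_m1 k al be) * (delta_p1 k al be - x))
            * jacobi_weight al be x) * jacobiPn k al be x.

(* Main.v *)
Require Import Defs.
From mathcomp Require Import all_boot all_order all_algebra.
From mathcomp Require Import all_classical all_reals all_analysis.
From mathcomp Require Import ring lra.
Import Order.TTheory GRing.Theory Num.Theory.
Import numFieldNormedType.Exports.
Set Implicit Arguments. Unset Strict Implicit. Unset Printing Implicit Defensive.
Local Open Scope ring_scope.

(** Write [s = 2k + al + be + 1], [w] for the weight and [y = w P^2].  In the
    variable [xi = artanh x] the function [q = sqrt w * P] satisfies
    [q'' + (Q / 4) q = 0] with [Q = s^2 D - (1 - x^2)] quadratic in [x], where
    [D = (x - delta_m1) (delta_p1 - x)].  Hence for every smooth [psi] the form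
    [F = psi (q'^2 + Q q^2 / 4) - psi' q q' + psi'' q^2 / 2] satisfies
    [F' = q^2 (psi''' / 2 + psi' Q / 2 + psi Q' / 4)] and vanishes at [x = -1].
    The choices [psi = 1] and [psi = x] give the first two moments of [y dx].

    To bound [y] at a point [x] of the right half of the interval take
    [psi = (A - x)^(-1/2)] with [A] slightly beyond the turning point
    [delta_p1].  Then [dF/dx] is at most [y (4 s^2 - 1) sqrt (A - x) / 16], and
    the moments bound the integral of [sqrt (A - x) y].  On the other hand
    [F (x)] dominates [y] times an explicit quantity, which gives the result.

    When [al >= 1/2], the shift [L = A - x] is chosen as a root of the
    polynomial for which the bound on [dF/dx] becomes sharp at [x].  When
    [al < 1/2] one takes [A = 1]; then [dF/dx] has an excess term of order
    [y (1 - x)^(-3/2)], which near [x = 1] is absorbed by evaluating everything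
    at the maximum of [sqrt (1 - x) y].  The left half follows by the
    reflection [x -> - x], so the core estimates are stated for an abstract
    solution of the Jacobi equation. *)

(** * Algebraic inequalities for the choice of the shift *)

(** The inequality left after squaring in [bound_of_shift]: [676 / 625] is [(26 / 25) ^+ 2], and
    [9 / 5] is the constant of the theorem. It is homogeneous, so [k] scales to [1]; in [r] and [e]
    it then follows linearly from the listed signs. *)
Lemma shift_balance (R : realFieldType) (k sg e : R) : 0 < k -> k <= sg -> 0 <= e ->
  676 / 625 * (k * sg * (k + e) * (e + 81 / 80 * ((k + sg) / 2)))
    <= 9 / 5 * (k * sg + e * (k + sg + e) / 5) ^+ 2.
Proof.
move=> k0 ksg e0.
have [r r0 ->] : exists2 r, 0 <= r & sg = k * (1 + r).
  exists (sg / k - 1); last by field; rewrite gt_eqF.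
  by rewrite subr_ge0 ler_pdivlMr // mul1r.
have [{e0} {}e e0 ->] : exists2 e', 0 <= e' & e = k * e'.
  by exists (e / k); [rewrite divr_ge0 // ltW | field; rewrite gt_eqF].
rewrite -subr_ge0.
rewrite (_ : _ - _ = k ^+ 4 * (9/5*((1+r)+e*(1+(1+r)+e)/5)^+2 -
   676/625 * ((1+r)*(1+e)*(e+81/80*((1+(1+r))/2))))); last by field.
apply: mulr_ge0 (exprn_ge0 4 (ltW k0)) _.
have h1 : 0 <= e * (e-1)^+2 by rewrite mulr_ge0 ?sqr_ge0.
have h2 : 0 <= r * (e * (e-1)^+2) by rewrite mulr_ge0.
have h3 : 0 <= r * (e - 2)^+2 by rewrite mulr_ge0 ?sqr_ge0.
have h4 : 0 <= (e-51/50)^+2 by exact: sqr_ge0.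
have h5 : 0 <= e^+4 by rewrite exprn_even_ge0.
have h6 : 0 <= r^+2*e by rewrite mulr_ge0 ?sqr_ge0.
have h7 : 0 <= r^+2*e^+2 by rewrite mulr_ge0 ?sqr_ge0.
have h8 : 0 <= r * e^+2 by rewrite mulr_ge0 ?sqr_ge0.
have h9 : 0 <= r^+2 by rewrite sqr_ge0.
have h10 : 0 <= e^+2 by rewrite sqr_ge0.
have h11 : 0 <= r*e by rewrite mulr_ge0.
lra.
Qed.

(* Error terms of [16 F'] for [psi = (A - x)^(-1/2)] at [x = A - L]: the bound on [F'] is sharp
   at [x] when [4 s^2 L^2 (L - k) (L + sg) = shift_defect x L], [k] and [sg] being the distances
   from [x] to the two turning points. *)
Definition shift_defect (R : realFieldType) (x L : R) : R :=
  15 * (1 - x ^+ 2) ^+ 2 - 36 * x * (1 - x ^+ 2) * L + (16 - 28 * (1 - x ^+ 2)) * L ^+ 2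
  + 8 * x * L ^+ 3 + L ^+ 4.
(** Divided by [L ^+ 2], this is the amount by which [16 * Num.sqrt L * shift_lower al be s (x + L)
    x] exceeds [4 * s ^+ 2 * (k * sg)]. *)
Definition shift_gain (R : realFieldType) (x L : R) : R :=
  (1 - x ^+ 2) * (5 * (1 - x ^+ 2) - 8 * x * L - 4 * L ^+ 2).

(** The difference is its value at [L = 1 - x] plus [1 - x - L] times a nonnegative factor. The
    threshold [- (1 / 10)] keeps [5 * (1 + x) ^+ 2 - 4], hence that value, nonnegative. *)
Lemma shift_defect_le_gain_right (R : realFieldType) (x L : R) :
  - (1 / 10) <= x -> 0 <= L -> L <= 1 - x -> shift_defect x L <= 5 * shift_gain x L.
Proof.
move=> hx L0 Lw.
set w := 1 - x in Lw.
have w0 : 0 <= w by lra.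
have xw : x = 1 - w by rewrite /w; lra.
have w11 : w <= 11 / 10 by lra.
have W1 : 1 - x ^+ 2 <= 1 by have := sqr_ge0 x; lra.
have W0 : 0 <= 1 - x ^+ 2 by rewrite (_ : _ - _ = w * (1 + x)) ?mulr_ge0 //; [lra|rewrite /w; ring].
have wL0 : 0 <= w * L by rewrite mulr_ge0.
have w20 := sqr_ge0 w; have L20 := sqr_ge0 L.
have F0 : 0 <= 4 * x * (1 - x ^+ 2) + (16 - 8 * (1 - x ^+ 2)) * (w + L)
   + 8 * x * (w ^+ 2 + w * L + L ^+ 2) + (w + L) * (w ^+ 2 + L ^+ 2).
  have h1 : 8 * (w + L) <= (16 - 8 * (1 - x ^+ 2)) * (w + L).
    by rewrite ler_wpM2r; lra.
  have h4 : 0 <= (w + L) * (w ^+ 2 + L ^+ 2) by rewrite mulr_ge0; lra.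
  have [x0|x0] := lerP 0 x.
    have h2 : 0 <= x * (1 - x ^+ 2) by rewrite mulr_ge0.
    have h3 : 0 <= x * (w ^+ 2 + w * L + L ^+ 2) by rewrite mulr_ge0 //; lra.
    lra.
  have w1 : 1 <= w by rewrite /w; lra.
  have h2 : - (1/10) * (1 - x ^+ 2) <= x * (1 - x ^+ 2) by rewrite ler_wpM2r.
  have h3 : - (1/10) * (w ^+ 2 + w * L + L ^+ 2) <= x * (w ^+ 2 + w * L + L ^+ 2).
    by rewrite ler_wpM2r //; lra.
  have h5 : w ^+ 2 <= 121/100 by nra.
  have h6 : w * L <= 121/100 by nra.
  have h7 : L ^+ 2 <= 121/100 by nra.
  lra.
have G0 : 0 <= w ^+ 2 * (5 * (2 - w) ^+ 2 - 4).
  rewrite mulr_ge0 //; nra.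
have FL : 0 <= (w - L) * (4 * x * (1 - x ^+ 2) + (16 - 8 * (1 - x ^+ 2)) * (w + L)
   + 8 * x * (w ^+ 2 + w * L + L ^+ 2) + (w + L) * (w ^+ 2 + L ^+ 2)).
  by rewrite mulr_ge0 // subr_ge0.
rewrite -subr_ge0 (_ : _ - _ = w ^+ 2 * (5 * (2 - w) ^+ 2 - 4) +
 (w - L) * (4 * x * (1 - x ^+ 2) + (16 - 8 * (1 - x ^+ 2)) * (w + L)
   + 8 * x * (w ^+ 2 + w * L + L ^+ 2) + (w + L) * (w ^+ 2 + L ^+ 2))); first lra.
rewrite /shift_defect /shift_gain xw; ring.
Qed.

(** Divided by [L ^+ 2], the difference is at least its value at [M], and there it is a polynomial
    in [u] alone. *)
Lemma shift_defect_le_gain_left (R : realFieldType) (u L : R) :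
  0 < u -> u <= 9 / 10 -> 0 <= L -> L <= u * (3 / 2 - u / 3) -> shift_defect (u - 1) L <= 5 * shift_gain (u - 1) L.
Proof.
move=> u0 u9 L0; set M := u * _ => LM.
have M0 : 0 < M by rewrite mulr_gt0 //; lra.
have Mu : M <= 3 / 2 * u by rewrite /M mulrC ler_wpM2r //; lra.
(* Bernstein basis on [0, 9/10] *)
have p n m : 0 <= u ^+ n * (9 / 10 - u) ^+ m by rewrite mulr_ge0 ?exprn_ge0 //; lra.
have TM : 0 <= 5 * shift_gain (u - 1) M - shift_defect (u - 1) M.
  rewrite (_ : _ - _ = u ^+ 2 * (16 + 55/3*u -(65+121/144)*u^+2 + 629/18*u^+3 -361/54*u^+4 + 14/27*u^+5 -1/81*u^+6)).
    apply: mulr_ge0 (sqr_ge0 u) _.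
    by move: (p 0 6) (p 1 5) (p 2 4) (p 3 3) (p 4 2) (p 5 1) (p 6 0); lra.
  by rewrite /shift_defect /shift_gain /M; field.
set W := 1 - (u - 1) ^+ 2.
have Wu : W = u * (2 - u) by rewrite /W; ring.
have W0 : 11/10 * u <= W by rewrite Wu mulrC ler_wpM2l //; lra.
suff H : 0 <= M ^+ 2 * (5 * shift_gain (u - 1) L - shift_defect (u - 1) L).
  by move: H; rewrite pmulr_rge0 ?subr_ge0 // exprn_gt0.
rewrite (_ : M ^+ 2 * _ = L ^+ 2 * (5 * shift_gain (u - 1) M - shift_defect (u - 1) M) + (M - L) * (
   10 * W ^+ 2 * (M + L) + 4 * (1 - u) * W * (L * M) - 8 * (1 - u) * (L * M) ^+ 2 + (L * M) ^+ 2 * (L + M))); last by rewrite /shift_defect /shift_gain /W; ring.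
have LM0 : 0 <= L * M by rewrite mulr_ge0 // ltW.
apply: addr_ge0; first by rewrite mulr_ge0 ?sqr_ge0.
apply: mulr_ge0; first by rewrite subr_ge0.
have h1 : 0 <= 4 * (1 - u) * W * (L * M) by rewrite !mulr_ge0 //; lra.
have h2 : 0 <= (L * M) ^+ 2 * (L + M) by rewrite mulr_ge0 ?sqr_ge0 //; lra.
suff : 8 * (1 - u) * (L * M) ^+ 2 <= 10 * W ^+ 2 * (M + L) by lra.
have W2 : 121/100 * u ^+ 2 <= W ^+ 2 by nra.
have LM1 : L * M <= (M + L) * u.
  nra.
have LM2 : L * M <= 9/4 * u ^+ 2.
  rewrite (_ : 9/4 * _ = (3/2 * u) * (3/2*u)); last by field.
  by rewrite ler_pM //; lra.
have : (L * M) ^+ 2 <= (M + L) * u * (9/4 * u ^+ 2).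
  by rewrite expr2 ler_pM.
have uu : u * (1 - u) <= 1 / 4 by have := sqr_ge0 (u - 1/2); lra.
move=> h3.
have h4 : 8 * (1 - u) * (L * M) ^+ 2 <= 8 * (1 - u) * ((M + L) * u * (9/4 * u ^+ 2)).
  by rewrite ler_wpM2l //; lra.
have h5 : 8 * (1 - u) * ((M + L) * u * (9/4 * u ^+ 2)) <= 18 * (M + L) * u ^+ 2 * (1 / 4).
  rewrite (_ : 8 * _ * _ = 18 * (M + L) * u ^+ 2 * (u * (1 - u))); last by field.
  by rewrite ler_wpM2l // !mulr_ge0 ?sqr_ge0 //; lra.
have h6 : 10 * (121/100 * u ^+ 2) * (M + L) <= 10 * W ^+ 2 * (M + L).
  by rewrite ler_wpM2r //; lra.
have h7 : 0 <= (M + L) * u ^+ 2 by rewrite mulr_ge0 ?sqr_ge0 //; lra.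
lra.
Qed.

(** Gives the sign at the right endpoint of the search interval of [exists_shift] when
    [x < - (1 / 10)]; [t] stands for [s * u]. The right-hand side increases with [t], so
    [t = 6 - 3 * u] is the worst case. *)
Lemma shift_defect_le_scaled (R : realFieldType) (u t L : R) : 0 < u -> u <= 9/10 -> 6 - 3 * u <= t ->
  L = u * (3 / 2 - u / 3) -> u ^+ 2 * shift_defect (u - 1) L <= 4 * t ^+ 2 * L ^+ 2 * (L ^+ 2 - u ^+ 2).
Proof.
move=> u0 u9 ht hL.
(* Bernstein basis on [0, 9/10] *)
have p n m : 0 <= u ^+ n * (9 / 10 - u) ^+ m by rewrite mulr_ge0 ?exprn_ge0 //; lra.
have h : u ^+ 2 * shift_defect (u - 1) L <= 4 * (6 - 3 * u) ^+ 2 * L ^+ 2 * (L ^+ 2 - u ^+ 2).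
  rewrite -subr_ge0 (_ : _ - _ = u ^+ 4 * (201 -494*u + (529+59/144)*u^+2 -(285+5/18)*u^+3 + (74+47/54)*u^+4 -250/27*u^+5 + 35/81*u^+6)).
    apply: mulr_ge0 (exprn_ge0 4 (ltW u0)) _.
    by move: (p 0 6) (p 1 5) (p 2 4) (p 3 3) (p 4 2) (p 5 1) (p 6 0); lra.
  by rewrite /shift_defect hL; field.
apply: (le_trans h).
have h0 : 0 <= L ^+ 2 - u ^+ 2.
  have -> : L ^+ 2 - u ^+ 2 = u ^+ 2 * ((3 / 2 - u / 3) ^+ 2 - 1) by rewrite hL; ring.
  have q0 : 0 <= 1/2 - u/3 by lra.
  apply: mulr_ge0 (sqr_ge0 u) _; have := mulr_ge0 q0 q0; lra.
have h1 : (6 - 3 * u) ^+ 2 <= t ^+ 2 by rewrite lerXn2r // nnegrE; lra.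
have h2 : 0 <= L ^+ 2 * (L ^+ 2 - u ^+ 2) by exact: mulr_ge0 (sqr_ge0 L) h0.
have := ler_wpM2l h2 h1; lra.
Qed.

(** Gives the sign at the left endpoint [L = k] in [exists_shift]. Written around the turning point
    [A = x + k], the claim reduces to [4 / 5 * k <= b + 4 / 5 * A * k]. *)
Lemma shift_defect_ge0 (R : realFieldType) (x k : R) : 0 <= k -> k <= 1 + x -> k <= 1 - x -> 0 <= shift_defect x k.
Proof.
move=> k0 ku kw; set A := x + k; set b := 1 - A ^+ 2.
have -> : shift_defect x k = 15 * (b + 4/5 * A * k) ^+ 2 - (28/5 + 2/5*b) * k ^+ 2 by rewrite /shift_defect /b /A; field.
have b1 : b <= 1 by rewrite /b; have := sqr_ge0 A; lra.
have A1 : A <= 1 by rewrite /A; lra.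
have hb : (1 - A) * (2 * k) <= b.
  by rewrite /b (_ : 1 - A ^+ 2 = (1 - A) * (1 + A)) ?ler_wpM2l // /A; [lra|lra|ring].
have h : 4/5 * k <= b + 4/5 * A * k by nra.
have : (4/5*k)^+2 <= (b + 4/5 * A * k)^+2 by rewrite lerXn2r // ?nnegrE; lra.
have := sqr_ge0 k; nra.
Qed.

Lemma su_lower (R : realFieldType) (s u : R) : 3 <= s -> 6 * s - 9 <= s ^+ 2 * u -> 6 - 3 * u <= s * u.
Proof.
move=> s3 hsu.
have su3 : 3 <= s * u.
  rewrite -(@ler_pM2l _ s); last lra.
  have : 0 <= 6 * s - 9 - s * 3 by lra.
  lra.
rewrite leNgt; apply/negP => hlt.
have := mulr_gt0 (_ : 0 < s) (_ : 0 < 6 - 3 * u - s * u); rewrite subr_gt0 => /(_ ltac:(lra) hlt); lra.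
Qed.

(** Intermediate value theorem for [q] on an interval [[k, b]]. For [x >= - (1 / 10)] take
    [b = 1 - x], where the last hypothesis gives the sign. Further left a smaller [b] is needed for
    [shift_defect_le_gain_left] to apply. *)
Lemma exists_shift (R : rcfType) (s x k sg : R) :
  3 <= s -> 0 < k -> k <= sg -> sg <= 1 + x -> k <= 1 - x ->
  6 * s - 9 <= s ^+ 2 * (1 + x) -> 1 <= s ^+ 2 * ((1 - x - k) * (1 - x + sg)) ->
  exists L, [/\ k <= L, L <= 1 - x, 4 * s ^+ 2 * L ^+ 2 * ((L - k) * (L + sg)) = shift_defect x L
     & shift_defect x L <= 5 * shift_gain x L].
Proof.
move=> s3 k0 ksg sgu kw su al.
set q : {poly R} := (4 * s ^+ 2)%:P * 'X ^+ 2 * (('X - k%:P) * ('X + sg%:P)) -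
  ((15 * (1 - x ^+ 2) ^+ 2)%:P - (36 * x * (1 - x ^+ 2))%:P * 'X + (16 - 28 * (1 - x ^+ 2))%:P * 'X ^+ 2
  + (8 * x)%:P * 'X ^+ 3 + 'X ^+ 4).
have qE L : q.[L] = 4 * s ^+ 2 * L ^+ 2 * ((L - k) * (L + sg)) - shift_defect x L.
  by rewrite /q /shift_defect !hornerE.
have qk : q.[k] <= 0.
  by rewrite qE subrr mul0r mulr0 sub0r oppr_le0 shift_defect_ge0 //; lra.
have root_of b : k <= b -> 0 <= q.[b] -> exists L, [/\ k <= L, L <= b & 4 * s ^+ 2 * L ^+ 2 * ((L - k) * (L + sg)) = shift_defect x L].
  move=> kb qb; have [|L /andP[kL Lb] /rootP] := @poly_ivt R q k b kb; first by rewrite qk qb.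
  by rewrite qE => /eqP; rewrite subr_eq0 => /eqP; exists L.
have [x10|x10] := lerP (- (1/10)) x.
  have [|L [kL Lw eL]] := root_of (1 - x) kw.
    rewrite qE (_ : shift_defect x (1 - x) = 4 * (1 - x) ^+ 2); last by rewrite /shift_defect; ring.
    have := ler_wpM2l (sqr_ge0 (1 - x)) al; lra.
  exists L; split=> //; apply: shift_defect_le_gain_right => //; lra.
set u := 1 + x.
have xu : x = u - 1 by rewrite /u; lra.
have u0 : 0 < u by rewrite /u; lra.
have u9 : u <= 9/10 by rewrite /u; lra.
set b := u * (3 / 2 - u / 3).
have ub : u <= b by rewrite /b ler_peMr //; lra.
have [||L [kL Lb eL]] := root_of b.
- rewrite (le_trans _ ub) // /u; lra.
- have hE : u ^+ 2 * shift_defect (u - 1) b <= 4 * (s * u) ^+ 2 * b ^+ 2 * (b ^+ 2 - u ^+ 2).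
    apply: shift_defect_le_scaled => //; apply: su_lower => //.
  rewrite qE subr_ge0 -(@ler_pM2l _ (u ^+ 2)) ?exprn_gt0 // {1}xu.
  apply: (le_trans hE).
  (* As [k] and [sg] are at most [u] and [k <= sg], the turning points can be eliminated. *)
  have hb : b ^+ 2 - u ^+ 2 <= (b - k) * (b + sg).
    have h1 : 0 <= (sg - k) * b by rewrite mulr_ge0; lra.
    have h2 : k * sg <= u * u by rewrite ler_pM // /u; lra.
    lra.
  have h : 0 <= 4 * (s * u) ^+ 2 * b ^+ 2.
    by apply: mulr_ge0 (sqr_ge0 b); apply: mulr_ge0 (sqr_ge0 _).
  have := ler_wpM2l h hb; lra.
exists L; split => //.
  apply: (le_trans Lb).
  rewrite /b xu; have := mulr_ge0 (ltW u0) (ltW u0).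
  have : 0 <= (9/10 - u) * u by rewrite mulr_ge0; lra.
  nra.
rewrite xu; apply: shift_defect_le_gain_left => //; lra.
Qed.

(** The identity for [L ^+ 2 * f L'] shows that [f y / y ^+ 2] does not fall below its value at [L].
    With [y = A - z], a root at [z = x] gives the sign at every [z] between [-1] and [x]. *)
Lemma shift_poly_ge0 (R : realFieldType) (A G L L' : R) :
  A <= 1 -> 0 < L -> L <= L' -> L' <= 1 + A ->
  let f y := (G - 4 - 10 * (A ^+ 2 - 1)) * y ^+ 2 + 24 * A * (A ^+ 2 - 1) * y - 15 * (A ^+ 2 - 1) ^+ 2 in
  f L = 0 -> 0 <= f L'.
Proof.
move=> A1 L0 LL' L'A f fL.
rewrite -(@pmulr_rge0 _ (L ^+ 2)) ?exprn_gt0 //.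
have -> : L ^+ 2 * f L' = L' ^+ 2 * f L + (L' - L) * (3 * ((1 - A) * (1 + A)) * (8 * A * (L * L') + 5 * ((1 - A) * (1 + A)) * (L + L'))).
  by rewrite /f; ring.
rewrite fL mulr0 add0r mulr_ge0 ?subr_ge0 //.
have b0 : 0 <= (1 - A) * (1 + A) by rewrite mulr_ge0; lra.
rewrite !mulr_ge0 //; try lra.
have LL0 : 0 <= L * L' by rewrite mulr_ge0; lra.
have [A0|A0] := lerP 0 A.
  by rewrite addr_ge0 // ?mulr_ge0 //; lra.
have h1 : L * L' <= (1 + A) * L by rewrite mulrC ler_wpM2r //; lra.
have h2 : (- A) * (L * L') <= (- A) * ((1 + A) * L) by rewrite ler_wpM2l //; lra.
have h3 : (1 - A) * (1 + A) * (2 * L) <= (1 - A) * (1 + A) * (L + L') by rewrite ler_wpM2l //; lra.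
have h4 : 0 <= (1 + A) * L * (10 - 2 * A) by rewrite !mulr_ge0; lra.
lra.
Qed.

(** * The differential equation of Jacobi polynomials *)

Lemma gbinomS (R : realType) (a : R) m : gbinom a m.+1 * m.+1%:R = gbinom a m * (a - m%:R).
Proof.
rewrite /gbinom big_ord_recr /= factS natrM invfM.
have h : (m.+1)%:R != 0 :> R by rewrite pnatr_eq0.
have h' : (m`!)%:R != 0 :> R by rewrite pnatr_eq0 -lt0n fact_gt0.
by field; rewrite ?h ?h' // addrC natr1 h.
Qed.

Definition jacobi_coef (R : realType) (n : nat) (al be : R) (j : nat) : R :=
  gbinom (n%:R + al) (n - j) * gbinom (n%:R + be) j.

Definition jacobi_poly (R : realType) (n : nat) (al be : R) : {poly R} :=
  \sum_(j < n.+1) (jacobi_coef n al be j)%:P *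
    (((1 / 2)%:P * ('X - 1)) ^+ j * ((1 / 2)%:P * ('X + 1)) ^+ (n - j)).

Lemma horner_jacobi_poly (R : realType) n (al be x : R) : (jacobi_poly n al be).[x] = jacobiP n al be x.
Proof.
rewrite /jacobi_poly /jacobiP horner_sum; apply: eq_bigr => j _.
rewrite !hornerE /jacobi_coef.
by rewrite ![2^-1 * _]mulrC !mulrA.
Qed.

Lemma jacobi_coef_rec (R : realType) n (al be : R) j : (j < n)%N ->
  jacobi_coef n al be j.+1 * (j.+1%:R * (j.+1%:R + al)) = jacobi_coef n al be j * ((n - j)%:R * ((n - j)%:R + be)).
Proof.
move=> jn; rewrite /jacobi_coef.
have e1 := gbinomS (n%:R + al) (n - j.+1).
have e2 := gbinomS (n%:R + be) j.
rewrite subnSK // in e1.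
have n1 : (n - j.+1)%:R = n%:R - j.+1%:R :> R by rewrite natrB.
have n2 : (n - j)%:R = n%:R - j%:R :> R by rewrite natrB // ltnW.
rewrite n1 in e1.
set A := gbinom _ (n - j.+1) in e1 *; set B := gbinom _ (n - j) in e1 *.
set C := gbinom _ j.+1 in e2 *; set D := gbinom _ j in e2 *.
have -> : A * C * (j.+1%:R * (j.+1%:R + al)) = (A * (n%:R + al - (n%:R - j.+1%:R))) * (C * j.+1%:R) by ring.
by rewrite -e1 e2 n2; ring.
Qed.

(* Since [Y - X = 1], the operator preserves homogeneity in [X] and [Y]. *)
Lemma jacobi_operator_monomial (R : realType) (al be x : R) j m :
  let X := (1 / 2)%:P * ('X - 1) : {poly R} in let Y := (1 / 2)%:P * ('X + 1) : {poly R} in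
  let q := X ^+ j * Y ^+ m in
  let a := (x - 1) / 2 in let b := (x + 1) / 2 in
  (1 - x ^+ 2) * q^`()^`().[x] + (be - al - (al + be + 2) * x) * q^`().[x]
   + (j + m)%:R * ((j + m)%:R + al + be + 1) * q.[x] =
  (j%:R * (j%:R + al) + m%:R * (m%:R + be)) * (a ^+ j * b ^+ m)
   - j%:R * (j%:R + al) * (a ^+ j.-1 * b ^+ m.+1) - m%:R * (m%:R + be) * (a ^+ j.+1 * b ^+ m.-1).
Proof.
move=> X Y q a b.
have dX : X^`() = (1 / 2)%:P by rewrite /X !poly.derivE; ring.
have dY : Y^`() = (1 / 2)%:P by rewrite /Y !poly.derivE; ring.
have hX : X.[x] = a by rewrite /X !hornerE /a; field.
have hY : Y.[x] = b by rewrite /Y !hornerE /b; field.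
have dXn i : (X ^+ i)^`() = (i%:R / 2)%:P * X ^+ i.-1.
  by rewrite deriv_exp dX -mulrnAl -polyCMn; congr (_%:P * _); rewrite -mulr_natl; field.
have dYn i : (Y ^+ i)^`() = (i%:R / 2)%:P * Y ^+ i.-1.
  by rewrite deriv_exp dY -mulrnAl -polyCMn; congr (_%:P * _); rewrite -mulr_natl; field.
have ha : x = a + b by rewrite /a /b; field.
have hb : b = a + 1 by rewrite /a /b; field.
rewrite /q {q}; clearbody X Y.
rewrite !derivM !dXn !dYn !derivD !derivM !dXn !dYn !derivC !hornerE hX hY.
rewrite natrD.
have -> : x = 2 * a + 1 by lra.
rewrite hb.
move: a {ha hb hX} => a.
case: j => [|[|j]]; case: m => [|[|m]] /=; rewrite ?exprS ?expr0 -?natr1 ?mulr0n; by field.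
Qed.

(** By [jacobi_operator_monomial] and [jacobi_coef_rec] the term of index [j] is [U j - U (j - 1)].
    The sum telescopes to [U n], which carries the factor [n - n]; [V] is [U] shifted so that the
    missing term at [j = 0] is [0]. *)
Lemma jacobi_poly_ode (R : realType) n (al be x : R) :
  let p := jacobi_poly n al be in
  (1 - x ^+ 2) * p^`()^`().[x] + (be - al - (al + be + 2) * x) * p^`().[x]
   + n%:R * (n%:R + al + be + 1) * p.[x] = 0.
Proof.
move=> p.
set a := (x - 1) / 2; set b := (x + 1) / 2.
pose U j : R := jacobi_coef n al be j * ((n - j)%:R * ((n - j)%:R + be)) *
   (a ^+ j * b ^+ (n - j) - a ^+ j.+1 * b ^+ (n - j).-1).
pose V j : R := if j is i.+1 then U i else 0.
have ds (F : 'I_n.+1 -> {poly R}) : (\sum_j F j)^`() = \sum_j (F j)^`() by exact: raddf_sum.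
rewrite /p /jacobi_poly !ds !horner_sum !mulr_sumr -!big_split /=.
rewrite (eq_bigr (fun j : 'I_n.+1 => V j.+1 - V j)).
  rewrite -(big_mkord xpredT (fun j => V j.+1 - V j)) telescope_sumr //.
  by rewrite /V /U subnn mul0r mulr0 mul0r subr0.
move=> [j jn] _ /=; rewrite ltnS in jn.
set q := (X in (_ * X)^`()^`()).
have -> : (1 - x ^+ 2) * ((jacobi_coef n al be j)%:P * q)^`()^`().[x] +
    (be - al - (al + be + 2) * x) * ((jacobi_coef n al be j)%:P * q)^`().[x] +
    n%:R * (n%:R + al + be + 1) * ((jacobi_coef n al be j)%:P * q).[x] =
    jacobi_coef n al be j * ((1 - x ^+ 2) * q^`()^`().[x] + (be - al - (al + be + 2) * x) * q^`().[x] +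
       (j + (n - j))%:R * ((j + (n - j))%:R + al + be + 1) * q.[x]).
  by rewrite subnKC // !mul_polyC !derivZ !hornerZ; ring.
rewrite jacobi_operator_monomial -/a -/b.
case: j jn {q} => [|j] jn /=; rewrite /U.
  by rewrite subn0; ring.
have e := jacobi_coef_rec al be jn.
have -> : (n - j).-1 = (n - j.+1)%N by rewrite subnS.
have -> : (n - j)%N = (n - j.+1).+1 by rewrite subnSK.
rewrite subnSK //= in e *.
have -> (z t : R) : jacobi_coef n al be j * ((n - j)%:R * ((n - j)%:R + be)) * (z - t) =
   jacobi_coef n al be j.+1 * (j.+1%:R * (j.+1%:R + al)) * (z - t) by rewrite e.
by ring.
Qed.

Local Open Scope classical_set_scope.

(** * Energy functionals *)

Lemma within_continuousM (R : realType) (A : set R) (f g : R -> R) :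
  {within A, continuous f} -> {within A, continuous g} -> {within A, continuous (f * g)}.
Proof. by move=> cf cg x; apply: cvgM; [exact: cf|exact: cg]. Qed.

(* [Y] is a primitive of [w p^2]; the real [s] plays the role of [2 k + al + be + 1]. *)
Record jacobi_system (R : realType) (al be s : R) (p : {poly R}) (w Y : R -> R) : Prop :=
  JacobiSystem {
  js_ode : forall x, (1 - x ^+ 2) * p^`()^`().[x] + (be - al - (al + be + 2) * x) * p^`().[x]
             + (s ^+ 2 - (al + be + 1) ^+ 2) / 4 * p.[x] = 0;
  js_w0 : forall x, 0 <= w x;
  js_wc : {within `[-1, 1], continuous w};
  js_wd : forall x : R, -1 < x < 1 -> is_derive x 1 w (w x * (be / (1 + x) - al / (1 - x)));
  js_Yc : {within `[-1, 1], continuous Y};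
  js_Yd : forall x : R, -1 < x < 1 -> is_derive x 1 Y (w x * p.[x] ^+ 2)}.

(** The [Q] of the overview; its form [s ^+ 2 * D - (1 - x ^+ 2)] is recovered in
    [potential_halfwidth]. *)
Definition potential (R : realType) (al be s x : R) : R :=
  (s ^+ 2 - 1) * (1 - x ^+ 2) - 2 * al ^+ 2 * (1 + x) - 2 * be ^+ 2 * (1 - x).

Definition potential_poly (R : realType) (al be s : R) : {poly R} :=
  (s ^+ 2 - 1)%:P * (1 - 'X ^+ 2) - (2 * al ^+ 2)%:P * (1 + 'X) - (2 * be ^+ 2)%:P * (1 - 'X).

(* [q' = sqrt w * xi_deriv_poly], the derivative of [q = sqrt w * p] being taken in [xi]. *)
Definition xi_deriv_poly (R : realType) (al be : R) (p : {poly R}) : {poly R} :=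
  (1 - 'X ^+ 2) * p^`() + (1 / 2)%:P * (be%:P * (1 - 'X) - al%:P * (1 + 'X)) * p.

(* [f0], [f1], [f2] stand for [psi] and its first two derivatives in [xi]. *)
Definition energy (R : realType) (al be s : R) (p : {poly R}) (w f0 f1 f2 : R -> R) : R -> R :=
  w * (f0 * horner ((xi_deriv_poly al be p) ^+ 2 + (1 / 4)%:P * potential_poly al be s * p ^+ 2)
       - f1 * horner (p * xi_deriv_poly al be p) + f2 * horner ((1 / 2)%:P * p ^+ 2)).

(** This is [q'' = - (Q / 4) q] with [sqrt w] divided out: [d / d xi] is [(1 - x ^+ 2) d / dx] and
    multiplies [sqrt w] by [(be * (1 - x) - al * (1 + x)) / 2]. *)
Lemma deriv_xi_deriv_poly (R : realType) (al be s : R) p w Y (x : R) : jacobi_system al be s p w Y ->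
  (1 - x ^+ 2) * (xi_deriv_poly al be p)^`().[x] =
   - (potential al be s x / 4 * p.[x] + (be * (1 - x) - al * (1 + x)) / 2 * (xi_deriv_poly al be p).[x]).
Proof.
move=> /js_ode /(_ x) ode.
rewrite /xi_deriv_poly !poly.derivE !hornerE /= /potential.
move: ode; set P2 := p^`()^`().[x]; set P1 := p^`().[x]; set P0 := p.[x] => ode.
have e : (1 - x ^+ 2) * P2 = - ((be - al - (al + be + 2) * x) * P1 + (s ^+ 2 - (al + be + 1) ^+ 2) / 4 * P0) by lra.
apply/eqP; rewrite -subr_eq0; apply/eqP.
match goal with |- ?G = 0 => have -> : G = (1 - x ^+ 2) * ((1 - x ^+ 2) * P2) + (1 - x ^+ 2) * ((be - al - (al + be + 2) * x) * P1 + (s ^+ 2 - (al + be + 1) ^+ 2) / 4 * P0) by field end.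
by rewrite e; ring.
Qed.

Lemma horner_potential_poly (R : realType) (al be s x : R) : (potential_poly al be s).[x] = potential al be s x.
Proof. by rewrite /potential_poly /potential !hornerE. Qed.

(** The formula for [F'] of the overview, divided by [1 - x ^+ 2] because the derivative is taken in
    [x]. The terms in [q' ^+ 2] and [q q'] cancel. *)
Lemma is_derive_energy (R : realType) (al be s : R) p w Y (f0 f1 f2 : R -> R) (x d0 d1 d2 : R) :
  jacobi_system al be s p w Y -> -1 < x < 1 ->
  is_derive x 1 f0 d0 -> is_derive x 1 f1 d1 -> is_derive x 1 f2 d2 ->
  f1 x = (1 - x ^+ 2) * d0 -> f2 x = (1 - x ^+ 2) * d1 ->
  is_derive x 1 (energy al be s p w f0 f1 f2)
    (w x * p.[x] ^+ 2 * (d2 / 2 + d0 * potential al be s x / 2 +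
       f0 x * (2 * (be ^+ 2 - al ^+ 2) - 2 * (s ^+ 2 - 1) * x) / 4)).
Proof.
move=> js x11 D0 D1 D2 E1 E2.
have Dw := js_wd js x11.
have er := deriv_xi_deriv_poly x js.
set qa := xi_deriv_poly al be p ^+ 2 + (1 / 4)%:P * potential_poly al be s * p ^+ 2.
set qb := p * xi_deriv_poly al be p; set qc := (1 / 2)%:P * p ^+ 2.
have H := is_deriveM Dw (is_deriveD (is_deriveB (is_deriveM D0 (is_derive_poly qa x))
  (is_deriveM D1 (is_derive_poly qb x))) (is_deriveM D2 (is_derive_poly qc x))).
apply: (is_derive_eq H).
have er0 : (xi_deriv_poly al be p).[x] = (1 - x ^+ 2) * p^`().[x] + (be * (1 - x) - al * (1 + x)) / 2 * p.[x].
  by rewrite /xi_deriv_poly !hornerE /=; field.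
rewrite /qa /qb /qc; move: er er0.
set r := xi_deriv_poly al be p; move: r => r er er0 {H}.
rewrite !poly.derivE !fctE !hornerE /= E1 E2.
have [x0 x1] : 1 + x != 0 /\ 1 - x != 0 by split; rewrite gt_eqF //; lra.
have W0 : 1 - x ^+ 2 != 0.
  by rewrite (_ : 1 - x ^+ 2 = (1 + x) * (1 - x)) ?mulf_neq0 //; ring.
have {}er : r^`().[x] = - (potential al be s x / 4 * p.[x] + (be * (1 - x) - al * (1 + x)) / 2 * r.[x]) / (1 - x ^+ 2).
  by rewrite -er mulrC mulKf.
have {}er0 : p^`().[x] = (r.[x] - (be * (1 - x) - al * (1 + x)) / 2 * p.[x]) / (1 - x ^+ 2).
  by rewrite er0 addrK mulrC mulKf.
rewrite er er0 /potential /GRing.scale /=.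
by field; rewrite W0 x0 x1.
Qed.

Lemma is_derive_ge0_le (R : realType) (f df : R -> R) (a b : R) : a <= b ->
  {within `[a, b], continuous f} ->
  (forall x : R, a < x < b -> is_derive x 1 f (df x)) ->
  (forall x, a < x < b -> 0 <= df x) -> f a <= f b.
Proof.
move=> ab cf Df f0.
apply: (@ger0_derive1_ndecr _ f a b) => // x; rewrite in_itv /= => xab.
  by have [] := Df x xab.
by rewrite derive1E; have [_ ->] := Df x xab; exact: f0.
Qed.

Lemma continuous_energy (R : realType) (al be s : R) p w Y (f0 f1 f2 : R -> R) (a b : R) :
  jacobi_system al be s p w Y -> -1 <= a -> b <= 1 ->
  {within `[a, b], continuous f0} -> {within `[a, b], continuous f1} ->
  {within `[a, b], continuous f2} ->
  {within `[a, b], continuous (energy al be s p w f0 f1 f2)}.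
Proof.
move=> js a1 b1 c0 c1 c2; rewrite /energy.
have ch q : {within `[a, b], continuous (horner q)}.
  by apply: continuous_subspaceT => x; exact: continuous_horner.
apply: within_continuousM.
  apply: continuous_subspaceW (js_wc js) => x /=; rewrite !in_itv /= => /andP[ax xb].
  by rewrite (le_trans a1 ax) (le_trans xb b1).
apply: within_continuousD; last exact: within_continuousM.
by apply: within_continuousB; exact: within_continuousM.
Qed.

(** At [-1] the polynomial [xi_deriv_poly] equals [be * p] and the potential is [- 4 * be ^+ 2], so
    the factor of [f0] cancels. This also covers [be = 0], where [w] need not vanish. *)
Lemma energy_m1 (R : realType) (al be s : R) p w (f0 f1 f2 : R -> R) :
  f1 (-1) = 0 -> f2 (-1) = 0 -> energy al be s p w f0 f1 f2 (-1) = 0.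
Proof.
move=> e1 e2; rewrite /energy /xi_deriv_poly !fctE e1 e2 !mul0r subr0 addr0 /potential_poly !hornerE /=.
by field.
Qed.

Lemma energy_1 (R : realType) (al be s : R) p w (f0 f1 f2 : R -> R) :
  f1 1 = 0 -> f2 1 = 0 -> energy al be s p w f0 f1 f2 1 = 0.
Proof.
move=> e1 e2; rewrite /energy /xi_deriv_poly !fctE e1 e2 !mul0r subr0 addr0 /potential_poly !hornerE /=.
by field.
Qed.

(** * Mean and variance of the measure [w p^2 dx] *)

Definition jacobi_mean (R : realType) (al be s : R) : R := (be ^+ 2 - al ^+ 2) / (s ^+ 2 - 1).
Definition jacobi_var (R : realType) (al be s : R) : R :=
  (3 / 2 * (be ^+ 2 - al ^+ 2) * jacobi_mean al be s + (s ^+ 2 - 3) / 2 - al ^+ 2 - be ^+ 2)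
    / (s ^+ 2 - 4) - jacobi_mean al be s ^+ 2.

(** [F1] ([psi = 1]) and [F2] ([psi = x]) vanish at both endpoints; the two resulting linear
    relations determine [jacobi_mean] and [jacobi_var]. In the basis centred at these moments only
    [q0] contributes to the total. *)
Lemma quadratic_antiderivative (R : realType) (al be s : R) p w Y (q0 q1 q2 : R) :
  jacobi_system al be s p w Y -> 2 < s ->
  let v := jacobi_mean al be s in
  exists G : R -> R, [/\ {within `[-1, 1], continuous G},
    forall x : R, -1 < x < 1 -> is_derive x 1 G
      (w x * p.[x] ^+ 2 * (q0 + q1 * (x - v) + q2 * ((x - v) ^+ 2 - jacobi_var al be s)))
   & G 1 - G (-1) = q0 * (Y 1 - Y (-1))].
Proof.
move=> js s2 v.
have s4 : s ^+ 2 - 4 != 0 by rewrite gt_eqF //; have := mulr_gt0 (_ : 0 < s - 2) (_ : 0 < s + 2); lra.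
have s1 : s ^+ 2 - 1 != 0 by rewrite gt_eqF //; have := mulr_gt0 (_ : 0 < s - 2) (_ : 0 < s + 2); lra.
set h := be ^+ 2 - al ^+ 2.
set F1 := energy al be s p w (cst 1) (cst 0) (cst 0).
set fx1 := horner (1 - 'X ^+ 2) : R -> R.
set fx2 := horner ((1 - 'X ^+ 2) * (- 2%:P * 'X)) : R -> R.
set F2 := energy al be s p w id fx1 fx2.
have D1 (x : R) : -1 < x < 1 -> is_derive x 1 F1 (w x * p.[x] ^+ 2 * ((h - (s ^+ 2 - 1) * x) / 2)).
  move=> x11; apply: is_derive_eq.
    apply: (is_derive_energy js x11 (is_derive_cst _ _ _) (is_derive_cst _ _ _) (is_derive_cst _ _ _)).
      by rewrite mulr0.
    by rewrite mulr0.
  by rewrite /cst /h; field.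
have D2 (x : R) : -1 < x < 1 -> is_derive x 1 F2 (w x * p.[x] ^+ 2 *
   (- (s ^+ 2 - 4) * x ^+ 2 + 3 / 2 * h * x + (s ^+ 2 - 3) / 2 - al ^+ 2 - be ^+ 2)).
  move=> x11; apply: is_derive_eq.
    apply: (is_derive_energy js x11 (is_derive_id _ _) (is_derive_poly _ _) (is_derive_poly _ _)).
      by rewrite /fx1 !hornerE.
    by rewrite /fx2 !poly.derivE !hornerE /=; ring.
  by rewrite /potential !poly.derivE !hornerE /= /h; field.
have c1 : {within `[-1, 1], continuous F1}.
  by apply: (continuous_energy js) => //; apply: continuous_subspaceT => x; exact: cvg_cst.
have c2 : {within `[-1, 1], continuous F2}.
  apply: (continuous_energy js) => //; apply: continuous_subspaceT => x.
  - exact: cvg_id.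
  - exact: continuous_horner.
  - exact: continuous_horner.
(* [k2] matches the coefficient of [x ^+ 2], then [k1] that of [x]; the constant terms agree by the
   values of the two moments. *)
set k2 := - q2 / (s ^+ 2 - 4).
set k1 := - (2 / (s ^+ 2 - 1)) * (q1 + q2 * (3 / 2 * h / (s ^+ 2 - 4) - 2 * v)).
have cc (c : R) : {within `[-1, 1], continuous (cst c : R -> R)}.
  by apply: continuous_subspaceT => x; exact: cvg_cst.
exists (cst q0 * Y + (cst k1 * F1 + cst k2 * F2)); split.
- apply: within_continuousD; first exact: within_continuousM (js_Yc js).
  by apply: within_continuousD; exact: within_continuousM.
- move=> x x11.
  have H := is_deriveD (is_deriveM (is_derive_cst q0 x 1) (js_Yd js x11))
    (is_deriveD (is_deriveM (is_derive_cst k1 x 1) (D1 x x11)) (is_deriveM (is_derive_cst k2 x 1) (D2 x x11))).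
  apply: (is_derive_eq H).
  rewrite /cst /GRing.scale /= /k1 /k2 /jacobi_var /v /jacobi_mean -/h.
  by field; rewrite s4 s1.
- rewrite !fctE /F1 /F2 !energy_1 ?energy_m1 /cst /fx1 /fx2 ?hornerE //=; ring.
Qed.

(** * The functional with [psi = (A - x)^(-1/2)] *)

Definition shift_poly (R : realType) (al be s A y : R) : R :=
  (- 4 * (potential al be s A + 1 - A ^+ 2) - 4 - 10 * (A ^+ 2 - 1)) * y ^+ 2
  + 24 * A * (A ^+ 2 - 1) * y - 15 * (A ^+ 2 - 1) ^+ 2.

Lemma is_derive_invsqrt (R : realType) (A x : R) : x < A ->
  is_derive x 1 (fun y => (Num.sqrt (A - y))^-1) ((Num.sqrt (A - x))^-1 ^+ 3 / 2).
Proof.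
move=> xA.
have Ax : 0 < A - x by rewrite subr_gt0.
have t0 : 0 < Num.sqrt (A - x) by rewrite sqrtr_gt0.
have D1 : is_derive x 1 (cst A - id : R -> R) (-1).
  by apply: is_derive_eq; rewrite sub0r.
have D2 := @is_derive1_comp _ Num.sqrt _ x _ _ (is_derive1_sqrt Ax) D1.
have tx : (Num.sqrt \o (cst A - id : R -> R)) x != 0 by rewrite gt_eqF.
have := is_deriveV tx D2.
rewrite /comp /= => D3; apply: (is_derive_eq D3).
rewrite !fctE /cst /GRing.scale /=.
move: t0; set t := Num.sqrt _ => t0.
have tn : t != 0 by rewrite gt_eqF.
by field.
Qed.

(** [f1] and [f2] are the derivatives of [psi = z] in [xi]. In [16 F' / y], everything but the
    leading term is collected in [shift_poly]. The lower bound on [F] completes the square in [q']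
    and drops it. *)
Lemma shifted_functional (R : realType) (al be s A : R) p w Y :
  jacobi_system al be s p w Y ->
  exists F : R -> R, [/\ F (-1) = 0,
    forall b, b <= 1 -> b < A -> {within `[-1, b], continuous F},
    forall x : R, -1 < x < 1 -> x < A -> is_derive x 1 F (w x * p.[x] ^+ 2 *
      (((4 * s ^+ 2 - 1) * Num.sqrt (A - x) - shift_poly al be s A (A - x) / Num.sqrt (A - x) ^+ 7) / 16))
   & forall x, x < A -> w x * p.[x] ^+ 2 *
      ((4 * potential al be s x - 8 * x * (1 - x ^+ 2) / (A - x) + 5 * (1 - x ^+ 2) ^+ 2 / (A - x) ^+ 2)
        / (16 * Num.sqrt (A - x))) <= F x].
Proof.
move=> js.
set z : R -> R := fun y => (Num.sqrt (A - y))^-1.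
set f1 : R -> R := horner ((1 / 2)%:P * (1 - 'X ^+ 2)) * z ^+ 3.
set f2 : R -> R := horner (- ('X * (1 - 'X ^+ 2))) * z ^+ 3 + horner ((3 / 4)%:P * (1 - 'X ^+ 2) ^+ 2) * z ^+ 5.
have zt (x : R) : x < A -> exists2 t, 0 < t & z x = t^-1 /\ (Num.sqrt (A - x) = t /\ A - x = t ^+ 2).
  move=> xA; exists (Num.sqrt (A - x)); first by rewrite sqrtr_gt0 subr_gt0.
  by rewrite sqr_sqrtr // subr_ge0 ltW.
have Dz (x : R) : x < A -> is_derive x 1 z (z x ^+ 3 / 2) by move=> xA; exact: is_derive_invsqrt.
exists (energy al be s p w z f1 f2); split.
- by apply: energy_m1; rewrite /f1 /f2 !fctE !hornerE /=; ring.
- move=> b b1 bA.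
  have cz : {within `[-1, b], continuous z}.
    apply: derivable_within_continuous => x; rewrite in_itv /= => /andP[_ xb].
    by have [] := Dz x (le_lt_trans xb bA).
  have ch q : {within `[-1, b], continuous (horner q)}.
    by apply: continuous_subspaceT => x; exact: continuous_horner.
  have cX n : {within `[-1, b], continuous (z ^+ n.+1)}.
    by elim: n => [|n IH]; [rewrite expr1 | rewrite exprS; exact: within_continuousM].
  apply: (continuous_energy js) => //; first exact: within_continuousM.
  by apply: within_continuousD; exact: within_continuousM.
- move=> x x11 xA.
  have D0 := Dz x xA.
  have D1 := is_deriveM (is_derive_poly ((1 / 2)%:P * (1 - 'X ^+ 2)) x) (is_deriveX 3 D0).
  have D2 := is_deriveD (is_deriveM (is_derive_poly (- ('X * (1 - 'X ^+ 2))) x) (is_deriveX 3 D0))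
      (is_deriveM (is_derive_poly ((3 / 4)%:P * (1 - 'X ^+ 2) ^+ 2) x) (is_deriveX 5 D0)).
  have [t t0 [zx [st At]]] := zt x xA.
  have tn : t != 0 by rewrite gt_eqF.
  have e1 : f1 x = (1 - x ^+ 2) * (z x ^+ 3 / 2).
    by rewrite /f1 !fctE !hornerE /=; field.
  have H := is_derive_energy js x11 D0 D1 D2 e1.
  apply: is_derive_eq.
    apply: H; rewrite /f2 !fctE !poly.derivE !hornerE /= /GRing.scale /= zx.
    by field.
  rewrite !fctE !poly.derivE !hornerE /= /GRing.scale /= zx st At /shift_poly.
  have -> : A = x + t ^+ 2 by lra.
  rewrite /potential.
  by field.
- move=> x xA.
  have [t t0 [zx [st At]]] := zt x xA.
  have tn : t != 0 by rewrite gt_eqF.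
  rewrite /energy !fctE -subr_ge0.
  have e : (xi_deriv_poly al be p ^+ 2 + (1 / 4)%:P * potential_poly al be s * p ^+ 2).[x] = (xi_deriv_poly al be p).[x] ^+ 2 + potential al be s x / 4 * p.[x] ^+ 2.
    rewrite hornerD horner_exp !hornerM horner_potential_poly hornerC; set c := (xi_deriv_poly _ _ _).[x]; by field.
  rewrite e hornerM /f1 /f2 !fctE.
  set r := (xi_deriv_poly al be p).[x]; set P0 := p.[x].
  rewrite !hornerE /= zx st At.
  match goal with |- is_true (0 <= ?G) => have -> : G = w x * (t^-1 * (r - (1 - x ^+ 2) / (4 * t ^+ 2) * P0) ^+ 2) end.
    rewrite /potential -/P0; field; exact: tn.
  apply: mulr_ge0 (js_w0 js x) _.
  by apply: mulr_ge0 (sqr_ge0 _); rewrite invr_ge0 ltW.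
Qed.

Definition jacobi_quad (R : realType) (al be s q0 q1 q2 x : R) : R :=
  q0 + q1 * (x - jacobi_mean al be s) + q2 * ((x - jacobi_mean al be s) ^+ 2 - jacobi_var al be s).

Definition shift_rate (R : realType) (al be s A x : R) : R :=
  ((4 * s ^+ 2 - 1) * Num.sqrt (A - x) - shift_poly al be s A (A - x) / Num.sqrt (A - x) ^+ 7) / 16.

Definition shift_lower (R : realType) (al be s A x : R) : R :=
  (4 * potential al be s x - 8 * x * (1 - x ^+ 2) / (A - x) + 5 * (1 - x ^+ 2) ^+ 2 / (A - x) ^+ 2)
        / (16 * Num.sqrt (A - x)).

(** Up to [x], [F] grows no faster than the primitive [G] of the quadratic; beyond [x] nonnegativity
    of the quadratic suffices for [G x <= G 1]. The moments evaluate [G 1 - G (-1)]. *)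
Lemma shifted_compare (R : realType) (al be s A x q0 q1 q2 : R) p w Y :
  jacobi_system al be s p w Y -> 2 < s -> -1 < x < 1 -> x < A ->
  (forall y, -1 < y < x -> shift_rate al be s A y <= jacobi_quad al be s q0 q1 q2 y) ->
  (forall y, -1 < y < 1 -> 0 <= jacobi_quad al be s q0 q1 q2 y) ->
  w x * p.[x] ^+ 2 * shift_lower al be s A x <= q0 * (Y 1 - Y (-1)).
Proof.
move=> js s2 /andP[x1 x1'] xA hle hge.
have [F [F0 Fc Fd Fl]] := shifted_functional A js.
have [G [Gc Gd GI]] := quadratic_antiderivative q0 q1 q2 js s2.
have y0 y : 0 <= w y * p.[y] ^+ 2 by apply: mulr_ge0 (js_w0 js y) (sqr_ge0 _).
apply: (le_trans (Fl x xA)); rewrite -GI.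
have sub a b : -1 <= a -> b <= 1 -> {within `[a, b], continuous G}.
  move=> a1 b1; apply: continuous_subspaceW Gc => z /=; rewrite !in_itv /= => /andP[az zb].
  by rewrite (le_trans a1 az) (le_trans zb b1).
have h1 : (G - F) (-1) <= (G - F) x.
  apply: (is_derive_ge0_le (df := fun z => w z * p.[z] ^+ 2 * jacobi_quad al be s q0 q1 q2 z
        - w z * p.[z] ^+ 2 * shift_rate al be s A z)).
  - exact: ltW.
  - apply: within_continuousB; first by apply: sub => //; exact: ltW.
    by apply: Fc => //; exact: ltW.
  - move=> z /andP[z1 zx].
    have z11 : -1 < z < 1 by rewrite z1 (lt_trans zx x1').
    by apply: is_deriveB; [exact: Gd | apply: Fd => //; exact: lt_trans xA].
  - move=> z /andP[z1 zx]; rewrite -mulrBr mulr_ge0 // subr_ge0 hle // z1.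
    exact: zx.
have h2 : G x <= G 1.
  apply: (is_derive_ge0_le (df := fun z => w z * p.[z] ^+ 2 * jacobi_quad al be s q0 q1 q2 z)).
  - exact: ltW.
  - by apply: sub => //; exact: ltW.
  - by move=> z /andP[xz z1]; apply: Gd; rewrite (lt_trans x1 xz).
  - by move=> z /andP[xz z1]; rewrite mulr_ge0 // hge // (lt_trans x1 xz).
by move: h1; rewrite !fctE F0; lra.
Qed.

(** * The case [1/2 <= al] *)

Lemma sqr_le (R : realFieldType) (a b : R) : 0 <= a -> a <= b -> a ^+ 2 <= b ^+ 2.
Proof. by move=> a0 ab; rewrite lerXn2r // nnegrE (le_trans a0 ab). Qed.

Lemma sqr_lt (R : realFieldType) (a b : R) : 0 <= a -> a < b -> a ^+ 2 < b ^+ 2.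
Proof. by move=> a0 ab; rewrite ltrXn2r // nnegrE (le_trans a0 (ltW ab)). Qed.

Lemma le_of_sqr (R : realFieldType) (a b : R) : 0 <= b -> a ^+ 2 <= b ^+ 2 -> a <= b.
Proof. by move=> b0 ab; rewrite leNgt; apply/negP => /(sqr_lt b0); lra. Qed.

(** * Size of the interval and position of the moments relative to it *)

Lemma diff_sqr_bound (R : realType) (al be s : R) : 0 <= al -> 0 <= be -> al + be + 3 <= s ->
  `|be ^+ 2 - al ^+ 2| <= (s - 3) ^+ 2.
Proof.
move=> a0 b0 abs.
have h : (al + be) ^+ 2 <= (s - 3) ^+ 2 by apply: sqr_le; lra.
have h0 := mulr_ge0 a0 b0; have ha := sqr_ge0 al; have hb := sqr_ge0 be.
by rewrite ler_norml; apply/andP; split; lra.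
Qed.

(** [al + be + 3 <= s] encodes [1 <= k]. Both factors in the product are at least
    [s ^+ 2 - (s - 3) ^+ 2 = 6 * s - 9]. *)
Lemma halfwidth_lower (R : realType) (al be s d : R) : 0 <= al -> 0 <= be -> al + be + 3 <= s ->
  0 <= d -> (s ^+ 2 * d) ^+ 2 = (s ^+ 2 - (al + be) ^+ 2) * (s ^+ 2 - (al - be) ^+ 2) ->
  6 * s - 9 <= s ^+ 2 * d.
Proof.
move=> a0 b0 abs d0 e.
have h0 : 0 <= s ^+ 2 * d by rewrite mulr_ge0 ?sqr_ge0.
apply: le_of_sqr => //.
have ab := mulr_ge0 a0 b0.
have h : (al + be) ^+ 2 <= (s - 3) ^+ 2 by apply: sqr_le; lra.
rewrite e expr2 ler_pM //; lra.
Qed.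

(** Compares the centre of the interval with the mean; [1 / 80] is the source of the factor
    [81 / 80] in [N ^+ 2]. *)
Lemma mean_shift_bound (R : realType) (al be s d : R) : 0 <= al -> 0 <= be -> al + be + 3 <= s ->
  6 * s - 9 <= s ^+ 2 * d ->
  `|(be ^+ 2 - al ^+ 2) / s ^+ 2 - jacobi_mean al be s| <= d / 80.
Proof.
move=> a0 b0 abs hd.
have s3 : 3 <= s by lra.
have S9 : 9 <= s ^+ 2 by have := @sqr_le _ 3 s; lra.
have sn : s != 0 by rewrite gt_eqF //; lra.
have S0 : s ^+ 2 != 0 by rewrite gt_eqF //; lra.
have S1 : s ^+ 2 - 1 != 0 by rewrite gt_eqF //; lra.
have -> : (be ^+ 2 - al ^+ 2) / s ^+ 2 - jacobi_mean al be s = - (be ^+ 2 - al ^+ 2) / (s ^+ 2 * (s ^+ 2 - 1)).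
  by rewrite /jacobi_mean; field; rewrite ?sn ?S0 ?S1.
have den : 0 < s ^+ 2 * (s ^+ 2 - 1) by rewrite mulr_gt0; lra.
rewrite normrM normrN normfV (gtr0_norm den) ler_pdivrMr //.
apply: (le_trans (diff_sqr_bound a0 b0 abs)).
have h1 : (6 * s - 9) * (s ^+ 2 - 1) <= s ^+ 2 * d * (s ^+ 2 - 1) by rewrite ler_wpM2r //; lra.
have h2 : 80 * (s - 3) ^+ 2 <= (6 * s - 9) * (s ^+ 2 - 1).
  have t0 : 0 <= s - 3 by lra.
  have := mulr_ge0 t0 (sqr_ge0 (s - 3 - 3)); lra.
lra.
Qed.

(** Multiplied by [s ^+ 2 - 4], the variance is [d ^+ 2 * s ^+ 2 / 2 - 3 / 2 + B]; the spare
    [1 / 10] between [1 / 2] and [3 / 5] serves to absorb [B]. *)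
Lemma jacobi_var_bound (R : realType) (al be s d : R) : 0 <= al -> 0 <= be -> al + be + 3 <= s -> 7 / 2 <= s ->
  0 <= d -> (s ^+ 2 * d) ^+ 2 = (s ^+ 2 - (al + be) ^+ 2) * (s ^+ 2 - (al - be) ^+ 2) ->
  jacobi_var al be s <= 3 / 5 * d ^+ 2.
Proof.
move=> a0 b0 abs s72 d0 e.
have hd := halfwidth_lower a0 b0 abs d0 e.
have s0 : 0 < s by lra.
have S12 : (7 / 2) ^+ 2 <= s ^+ 2 by apply: sqr_le; lra.
have sn : s != 0 by rewrite gt_eqF //; lra.
have S0 : s ^+ 2 != 0 by rewrite gt_eqF //; lra.
have S1 : s ^+ 2 - 1 != 0 by rewrite gt_eqF //; lra.
have S4 : s ^+ 2 - 4 != 0 by rewrite gt_eqF //; lra.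
set h := be ^+ 2 - al ^+ 2.
have hh : h ^+ 2 <= ((s - 3) ^+ 2) ^+ 2.
  by rewrite -real_normK ?num_real // sqr_le // diff_sqr_bound.
have dE : d ^+ 2 = 1 - 2 * (al ^+ 2 + be ^+ 2) / s ^+ 2 + h ^+ 2 / (s ^+ 2) ^+ 2.
  apply: (mulfI (expf_neq0 2 S0)); rewrite -exprMn e /h; by field; rewrite ?sn.
have d1 : d ^+ 2 <= 1.
  have h4 : h ^+ 2 <= (al ^+ 2 + be ^+ 2) * s ^+ 2.
    have hab : al ^+ 2 + be ^+ 2 <= s ^+ 2.
      have : (al + be) ^+ 2 <= s ^+ 2 by apply: sqr_le; lra.
      by have := mulr_ge0 a0 b0; lra.
    have hp : 0 <= al ^+ 2 + be ^+ 2 by rewrite addr_ge0 ?sqr_ge0.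
    have := ler_wpM2l hp hab; have := mulr_ge0 (sqr_ge0 al) (sqr_ge0 be); rewrite /h; lra.
  have : h ^+ 2 / (s ^+ 2) ^+ 2 <= (al ^+ 2 + be ^+ 2) / s ^+ 2.
    rewrite ler_pdivrMr ?exprn_gt0 // (_ : _ / _ * _ = (al ^+ 2 + be ^+ 2) * s ^+ 2) //; by field; rewrite ?sn.
  have : 0 <= (al ^+ 2 + be ^+ 2) / s ^+ 2 by rewrite divr_ge0 ?addr_ge0 ?sqr_ge0.
  rewrite dE; lra.
set B := h ^+ 2 * (1 / (2 * s ^+ 2 * (s ^+ 2 - 1)) + 3 / (s ^+ 2 - 1) ^+ 2).
have vE : jacobi_var al be s * (s ^+ 2 - 4) = d ^+ 2 * s ^+ 2 / 2 - 3 / 2 + B.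
  by rewrite /jacobi_var /jacobi_mean /B -/h dE; field; rewrite ?sn ?S0 ?S1 ?S4.
have BB : B * s ^+ 2 <= 7 / 2 * (s - 3) ^+ 2.
  have b1 : 1 / (2 * s ^+ 2 * (s ^+ 2 - 1)) + 3 / (s ^+ 2 - 1) ^+ 2 <= 7 / 2 / (s ^+ 2 - 1) ^+ 2.
    rewrite -subr_ge0 (_ : _ - _ = 1 / (2 * s ^+ 2 * (s ^+ 2 - 1) ^+ 2)).
      by rewrite divr_ge0 //; apply: mulr_ge0 (sqr_ge0 _); apply: mulr_ge0 (sqr_ge0 _).
    by field; rewrite ?sn ?S0 ?S1.
  have b2 : B <= ((s - 3) ^+ 2) ^+ 2 * (7 / 2 / (s ^+ 2 - 1) ^+ 2).
    apply: ler_pM => //; first exact: sqr_ge0.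
    apply: addr_ge0; rewrite divr_ge0 ?sqr_ge0 //.
    by apply: mulr_ge0; [apply: mulr_ge0 (sqr_ge0 _) | lra].
  have b3 : (s * (s - 3)) ^+ 2 <= (s ^+ 2 - 1) ^+ 2.
    by apply: sqr_le; [rewrite mulr_ge0; lra|lra].
  have := ler_wpM2r (sqr_ge0 s) b2 => /le_trans; apply.
  rewrite (_ : _ * s ^+ 2 = 7 / 2 * (s - 3) ^+ 2 * ((s * (s - 3)) ^+ 2 / (s ^+ 2 - 1) ^+ 2)); last by field; rewrite ?sn ?S1.
  rewrite ler_piMr // ?ler_pdivrMr ?mul1r //; first exact: mulr_ge0 (sqr_ge0 _).
  by rewrite exprn_gt0 //; lra.
rewrite -(@ler_pM2r _ (s ^+ 2 - 4)); last lra.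
rewrite vE.
suff : B * s ^+ 2 <= (d ^+ 2 * (s ^+ 2 / 10 - 12 / 5) + 3 / 2) * s ^+ 2.
  rewrite ler_pM2r ?exprn_gt0 //; lra.
apply: (le_trans BB).
(* The coefficient [s ^+ 2 / 10 - 12 / 5] of [d ^+ 2] changes sign at [s ^+ 2 = 24]: above, the
   lower bound on [d] is used; below, [d ^+ 2 <= 1]. *)
have [S24|S24] := lerP 24 (s ^+ 2).
  have dl : (6 * s - 9) ^+ 2 <= d ^+ 2 * s ^+ 2 * s ^+ 2.
    rewrite (_ : d ^+ 2 * _ * _ = (s ^+ 2 * d) ^+ 2); last by ring.
    by apply: sqr_le => //; lra.
  rewrite -(@ler_pM2r _ (s ^+ 2)) ?exprn_gt0 //.
  have := ler_wpM2r (_ : 0 <= s ^+ 2 / 10 - 12 / 5) dl => /(_ ltac:(lra)) k1.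
  have s48 : 24 / 5 <= s.
    rewrite leNgt; apply/negP => hlt.
    have : s ^+ 2 < (24/5) ^+ 2 by apply: sqr_lt; lra.
    lra.
  have t0 : 0 <= s - 24/5 by lra.
  have t2 := sqr_ge0 (s - 24/5).
  have t3 := mulr_ge0 t0 t2.
  have t4 := mulr_ge0 t2 t2.
  lra.
have s5 : s <= 5.
  rewrite leNgt; apply/negP => hlt.
  have : 5 ^+ 2 < s ^+ 2 by apply: sqr_lt; lra.
  lra.
have k1 : (s ^+ 2 / 10 - 12 / 5) <= d ^+ 2 * (s ^+ 2 / 10 - 12 / 5).
  have := mulr_ge0 (_ : 0 <= 1 - d ^+ 2) (_ : 0 <= 12/5 - s ^+ 2 / 10) => /(_ ltac:(lra) ltac:(lra)); lra.
have k2 : 7 / 2 * (s - 3) ^+ 2 <= ((s ^+ 2 / 10 - 12 / 5) + 3 / 2) * s ^+ 2.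
  have t1 : 0 <= (s - 3) * (s ^+ 2 / 10 * (s + 3) - 7 / 2 * (s - 3)).
    rewrite mulr_ge0 //; first lra.
    have := ler_wpM2r (_ : 0 <= s + 3) S12 => /(_ ltac:(lra)); lra.
  lra.
apply: (le_trans k2); rewrite ler_wpM2r ?sqr_ge0 //; lra.
Qed.

(** Tangent of the square root at [N ^+ 2]; it makes the integral of [sqrt (A - x) y] accessible to
    the moments. *)
Lemma sqrt_le_line (R : realType) (N y : R) : 0 < N -> 0 <= y -> Num.sqrt y <= N / 2 + y / (2 * N).
Proof.
move=> N0 y0; rewrite -[in leRHS](sqr_sqrtr y0); set t := Num.sqrt y.
rewrite -subr_ge0 (_ : _ - _ = (N - t) ^+ 2 / (2 * N)).
  by rewrite divr_ge0 ?sqr_ge0 // mulr_ge0 // ltW.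
by field; rewrite gt_eqF.
Qed.

(** The tangent line alone is negative for large [z]; the quadratic term repairs this. The
    expression is smallest at [z = 15 / 4 * N ^+ 2]. *)
Lemma quadratic_majorant_ge0 (R : realType) (N m z : R) : 0 < N -> 9 / 10 * N ^+ 2 <= m ->
  0 <= N / 2 + m / (2 * N) - z / (2 * N) + z ^+ 2 / (15 * N ^+ 3).
Proof.
move=> N0 hm; have Nn : N != 0 by rewrite gt_eqF.
have -> : N / 2 + m / (2 * N) - z / (2 * N) + z ^+ 2 / (15 * N ^+ 3) =
  (m - 9 / 10 * N ^+ 2) / (2 * N) + ((z - 15 / 4 * N ^+ 2) ^+ 2 + 3 / 16 * (N ^+ 2) ^+ 2) / (15 * N ^+ 3).
  by field.
apply: addr_ge0; apply: divr_ge0.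
- by rewrite subr_ge0.
- by rewrite mulr_ge0 // ltW.
- by rewrite addr_ge0 ?sqr_ge0 // mulr_ge0 // sqr_ge0.
- by rewrite mulr_ge0 // exprn_ge0 // ltW.
Qed.

(** The estimate is squared and closed by [shift_balance]; strictness comes from
    [4 * s ^+ 2 - 1 < 4 * s ^+ 2]. *)
Lemma bound_of_shift (R : realType) (s k sg eps L N y I T : R) :
  3 <= s -> 0 < k -> k <= sg -> 0 <= eps -> L = k + eps -> 0 < N ->
  N ^+ 2 = eps + 81 / 80 * ((k + sg) / 2) -> 0 <= y -> 0 < I ->
  T = k * sg + eps * (k + sg + eps) / 5 ->
  y * (4 * s ^+ 2 * T / (16 * Num.sqrt L)) <= (4 * s ^+ 2 - 1) / 16 * (26 / 25 * N) * I ->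
  5 * (k * sg) * y ^+ 2 < 9 * I ^+ 2.
Proof.
move=> s3 k0 ksg eps0 LE N0 N2 y0 I0 TE main.
have S12 : 3 ^+ 2 <= s ^+ 2 by apply: sqr_le; lra.
have S0 : 0 < s ^+ 2 by lra.
have L0 : 0 < L by lra.
have t0 : 0 < Num.sqrt L by rewrite sqrtr_gt0.
have T0 : 0 < T.
  have : 0 < k * sg by rewrite mulr_gt0 //; lra.
  have : 0 <= eps * (k + sg + eps) by rewrite mulr_ge0 //; lra.
  rewrite TE; lra.
have {main} main : y * (4 * s ^+ 2) * T <= (4 * s ^+ 2 - 1) * (26 / 25 * (N * Num.sqrt L)) * I.
  have := ler_wpM2l (_ : 0 <= 16 * Num.sqrt L) main => /(_ ltac:(lra)).
  rewrite (_ : 16 * Num.sqrt L * (y * _) = y * (4 * s ^+ 2) * T); last by field; rewrite gt_eqF.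
  by rewrite (_ : 16 * Num.sqrt L * ((4 * s ^+ 2 - 1) / 16 * _ * I) = (4 * s ^+ 2 - 1) * (26 / 25 * (N * Num.sqrt L)) * I) //; field.
have {}main := sqr_le (_ : 0 <= y * (4 * s ^+ 2) * T) main.
have fin := shift_balance k0 ksg eps0; rewrite -TE in fin.
have kp : 0 <= 5 * (k * sg) by rewrite !mulr_ge0 //; lra.
have := ler_wpM2l kp (main _) => {main} main.
have {}main : 5 * (k * sg) * (y * (4 * s ^+ 2) * T) ^+ 2 <= 9 * (4 * s ^+ 2 - 1) ^+ 2 * I ^+ 2 * T ^+ 2.
  apply: le_trans (main _) _.
    by apply: mulr_ge0 (ltW T0); apply: mulr_ge0 => //; lra.
  have L2 : Num.sqrt L ^+ 2 = L by rewrite sqr_sqrtr // ltW.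
  rewrite (_ : 5 * (k * sg) * _ = 5 * ((4 * s ^+ 2 - 1) * I) ^+ 2 * (676 / 625 * (k * sg * (k + eps) * (eps + 81 / 80 * ((k + sg) / 2))))).
    rewrite (_ : 9 * _ * _ * _ = 5 * ((4 * s ^+ 2 - 1) * I) ^+ 2 * (9 / 5 * T ^+ 2)); last by field.
    by rewrite ler_wpM2l // mulr_ge0 // sqr_ge0.
  rewrite -N2 (_ : k + eps = Num.sqrt L ^+ 2); last by rewrite L2 LE.
  by field.
have T2 : 0 < (4 * s ^+ 2 * T) ^+ 2 by rewrite exprn_gt0 // mulr_gt0 //; lra.
rewrite -(ltr_pM2r T2).
rewrite (_ : 5 * (k * sg) * y ^+ 2 * _ = 5 * (k * sg) * (y * (4 * s ^+ 2) * T) ^+ 2); last by ring.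
apply: (le_lt_trans main).
rewrite (_ : 9 * _ * _ * _ = 9 * I ^+ 2 * T ^+ 2 * (4 * s ^+ 2 - 1) ^+ 2); last by ring.
have -> : 9 * I ^+ 2 * (4 * s ^+ 2 * T) ^+ 2 = 9 * I ^+ 2 * T ^+ 2 * (4 * s ^+ 2) ^+ 2 by ring.
rewrite ltr_pM2l; first by apply: sqr_lt; lra.
by rewrite !mulr_gt0 ?exprn_gt0.
Qed.

(** Left of [x], [shift_poly_ge0] allows [shift_poly] to be dropped from [shift_rate]. The constant
    [26 / 25] is [1 / 2 + 1 / 2] from the tangent plus [1 / 25] from the variance, as [3 / 5] over
    [15]. *)
Lemma bound_of_majorant (R : realType) (al be s d x L N : R) p w Y :
  jacobi_system al be s p w Y -> 3 <= s -> -1 < x -> x < 1 -> 0 < L -> x + L <= 1 ->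
  shift_poly al be s (x + L) L = 0 -> 0 < N ->
  9 / 10 * N ^+ 2 <= x + L - jacobi_mean al be s -> x + L - jacobi_mean al be s <= N ^+ 2 ->
  0 <= d -> d <= N ^+ 2 -> jacobi_var al be s <= 3 / 5 * d ^+ 2 -> 0 < Y 1 - Y (-1) ->
  w x * p.[x] ^+ 2 * shift_lower al be s (x + L) x <=
    (4 * s ^+ 2 - 1) / 16 * (26 / 25 * N) * (Y 1 - Y (-1)).
Proof.
move=> js s3 x1 x1' L0; set A := x + L => A1 fL N0; set v := jacobi_mean al be s => Av1 Av2 d0 dN hv I0.
have Nn : N != 0 by rewrite gt_eqF.
have K0 : 0 < (4 * s ^+ 2 - 1) / 16.
  by have := @sqr_le _ 3 s; clear -s3; lra.
set K := (4 * s ^+ 2 - 1) / 16 in K0 *.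
apply: (@le_trans _ _ (K * (N / 2 + (A - v) / (2 * N) + jacobi_var al be s / (15 * N ^+ 3)) * (Y 1 - Y (-1)))); last first.
  rewrite ler_pM2r // ler_pM2l //.
  have u1 : (A - v) / (2 * N) <= N / 2.
    by rewrite ler_pdivrMr ?mulr_gt0 //; clear -Av2; lra.
  have u2 : jacobi_var al be s / (15 * N ^+ 3) <= N / 25.
    rewrite ler_pdivrMr ?mulr_gt0 ?exprn_gt0 //.
    by have := sqr_le d0 dN; clear -hv; lra.
  by clear -u1 u2; lra.
have quadE y : jacobi_quad al be s (K * (N / 2 + (A - v) / (2 * N) + jacobi_var al be s / (15 * N ^+ 3)))
    (- K / (2 * N)) (K / (15 * N ^+ 3)) y =
    K * (N / 2 + (A - v) / (2 * N) - (y - v) / (2 * N) + (y - v) ^+ 2 / (15 * N ^+ 3)).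
  by rewrite /jacobi_quad -/v; field.
apply: (@shifted_compare R al be s A x _ (- K / (2 * N)) (K / (15 * N ^+ 3)) p w Y js) => [|||y|y].
- by clear -s3; lra.
- by rewrite x1.
- by rewrite ltrDl.
- move=> /andP[y1 y2]; rewrite quadE.
  have Ay : L <= A - y by rewrite /A; clear -y2; lra.
  have Ay0 : 0 <= A - y by exact: le_trans (ltW L0) Ay.
  have f0 : 0 <= shift_poly al be s A (A - y).
    apply: (@shift_poly_ge0 R A (- 4 * (potential al be s A + 1 - A ^+ 2)) L (A - y)) => //.
    by clear -y1; lra.
  apply: (@le_trans _ _ (K * Num.sqrt (A - y))).
    rewrite /shift_rate /K.
    have : 0 <= shift_poly al be s A (A - y) / Num.sqrt (A - y) ^+ 7 by rewrite divr_ge0 // exprn_ge0 // sqrtr_ge0.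
    by clear; lra.
  rewrite ler_pM2l //; apply: (le_trans (sqrt_le_line N0 Ay0)).
  rewrite (_ : N / 2 + (A - v) / (2 * N) - (y - v) / (2 * N) = N / 2 + (A - y) / (2 * N)); last by field.
  by rewrite lerDl divr_ge0 ?sqr_ge0 // mulr_ge0 // exprn_ge0 // ltW.
- by move=> _; rewrite quadE; apply: mulr_ge0; [exact: ltW | exact: quadratic_majorant_ge0].
Qed.

Lemma potential_halfwidth (R : realType) (al be s d y : R) : s != 0 ->
  (s ^+ 2 * d) ^+ 2 = (s ^+ 2 - (al + be) ^+ 2) * (s ^+ 2 - (al - be) ^+ 2) ->
  potential al be s y + 1 - y ^+ 2 = s ^+ 2 * (d ^+ 2 - (y - (be ^+ 2 - al ^+ 2) / s ^+ 2) ^+ 2).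
Proof.
move=> sn e.
have S2 : s ^+ 2 != 0 by rewrite expf_neq0.
apply: (mulfI S2).
have -> : s ^+ 2 * (s ^+ 2 * (d ^+ 2 - (y - (be ^+ 2 - al ^+ 2) / s ^+ 2) ^+ 2)) =
   (s ^+ 2 * d) ^+ 2 - (s ^+ 2 * y - (be ^+ 2 - al ^+ 2)) ^+ 2 by field.
by rewrite e /potential; ring.
Qed.

(** Evaluates [potential_halfwidth] at [1] and [-1], where the potential is [- 4 * al ^+ 2] and
    [- 4 * be ^+ 2]. *)
Lemma jacobi_edges (R : realType) (al be s d : R) : 0 <= al -> 0 <= be -> al + be + 3 <= s -> 0 <= d ->
  (s ^+ 2 * d) ^+ 2 = (s ^+ 2 - (al + be) ^+ 2) * (s ^+ 2 - (al - be) ^+ 2) ->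
  let c := (be ^+ 2 - al ^+ 2) / s ^+ 2 in
  [/\ 6 * s - 9 <= s ^+ 2 * (1 + c), c + d <= 1, -1 <= c - d &
      s ^+ 2 * ((1 - c - d) * (1 - c + d)) = 4 * al ^+ 2].
Proof.
move=> a0 b0 abs d0 e c.
have s0 : 0 < s by clear -a0 b0 abs; lra.
have sn : s != 0 by rewrite gt_eqF.
have S0 : 0 < s ^+ 2 by rewrite exprn_gt0.
have cE : s ^+ 2 * c = be ^+ 2 - al ^+ 2 by rewrite /c; field.
have := diff_sqr_bound a0 b0 abs; rewrite ler_norml => /andP[h1 h2].
have uc : 6 * s - 9 <= s ^+ 2 * (1 + c) by rewrite mulrDr mulr1 cE; clear -h1 h2; lra.
have uc' : 6 * s - 9 <= s ^+ 2 * (1 - c) by rewrite mulrBr mulr1 cE; clear -h1 h2; lra.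
have s9 : 0 < 6 * s - 9 by clear -a0 b0 abs; lra.
have c1 : 0 < 1 + c by rewrite -(pmulr_rgt0 _ S0); exact: lt_le_trans s9 uc.
have c1' : 0 < 1 - c by rewrite -(pmulr_rgt0 _ S0); exact: lt_le_trans s9 uc'.
have QE y := potential_halfwidth y sn e; rewrite -/c in QE.
have e1 : s ^+ 2 * ((1 - c - d) * (1 - c + d)) = 4 * al ^+ 2.
  by have := QE 1; rewrite /potential; clear; lra.
have em1 : s ^+ 2 * ((1 + c - d) * (1 + c + d)) = 4 * be ^+ 2.
  by have := QE (-1); rewrite /potential; clear; lra.
split=> //.
- have : 0 <= (1 - c - d) * (1 - c + d) by rewrite -(pmulr_rge0 _ S0) e1 mulr_ge0 ?sqr_ge0.
  by rewrite pmulr_lge0; clear -c1' d0; lra.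
- have : 0 <= (1 + c - d) * (1 + c + d) by rewrite -(pmulr_rge0 _ S0) em1 mulr_ge0 ?sqr_ge0.
  by rewrite pmulr_lge0; clear -c1 d0; lra.
Qed.

Lemma bound_right_ge_half (R : realType) (al be s d x : R) p w Y :
  jacobi_system al be s p w Y -> 1 / 2 <= al -> 0 <= be -> al + be + 3 <= s -> 0 <= d ->
  (s ^+ 2 * d) ^+ 2 = (s ^+ 2 - (al + be) ^+ 2) * (s ^+ 2 - (al - be) ^+ 2) ->
  (be ^+ 2 - al ^+ 2) / s ^+ 2 <= x -> x < (be ^+ 2 - al ^+ 2) / s ^+ 2 + d ->
  0 < Y 1 - Y (-1) ->
  5 * (d ^+ 2 - (x - (be ^+ 2 - al ^+ 2) / s ^+ 2) ^+ 2) * (w x * p.[x] ^+ 2) ^+ 2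
    < 9 * (Y 1 - Y (-1)) ^+ 2.
Proof.
move=> js al2 b0 abs d0 e; set c := (be ^+ 2 - al ^+ 2) / s ^+ 2 => xc xd I0.
have a0 : 0 <= al by clear -al2; lra.
have s72 : 7 / 2 <= s by clear -al2 b0 abs; lra.
have s3 : 3 <= s by clear -s72; lra.
have sn : s != 0 by rewrite gt_eqF //; clear -s3; lra.
have hd := halfwidth_lower a0 b0 abs d0 e.
have := mean_shift_bound a0 b0 abs hd; rewrite -/c ler_norml => /andP[hm1 hm2].
have hv := jacobi_var_bound a0 b0 abs s72 d0 e.
have [uc dp1 dm1 e1] := jacobi_edges a0 b0 abs d0 e; rewrite -/c in uc dp1 dm1 e1.
have QE y := potential_halfwidth y sn e; rewrite -/c in QE.
have S0 : 0 < s ^+ 2 by rewrite exprn_gt0 //; clear -s3; lra.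
have [k kE] : {k | k = c + d - x} by exists (c + d - x).
have [sg sgE] : {sg | sg = x - c + d} by exists (x - c + d).
have DE : d ^+ 2 - (x - c) ^+ 2 = k * sg by rewrite kE sgE; ring.
have k0 : 0 < k by clear -kE xd; lra.
have ksg : k <= sg by clear -kE sgE xc; lra.
have dks : d = (k + sg) / 2 by rewrite kE sgE; field.
have [L [kL Lw eL EJ]] : exists L, [/\ k <= L, L <= 1 - x, 4 * s ^+ 2 * L ^+ 2 * ((L - k) * (L + sg)) = shift_defect x L
     & shift_defect x L <= 5 * shift_gain x L].
  apply: exists_shift => //; [by clear -sgE dm1; lra | by clear -kE dp1; lra | |].
    by rewrite (le_trans uc) // ler_pM2l // lerD2l.
  (* Here [1 / 2 <= al] gives [1 <= 4 * al ^+ 2], the sign condition at [L = 1 - x]. *)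
  rewrite (_ : (1 - x - k) * (1 - x + sg) = (1 - c - d) * (1 - c + d)); last by rewrite kE sgE; ring.
  by rewrite e1; have := @sqr_le _ (1/2) al; clear -al2; lra.
have L0 : 0 < L by exact: lt_le_trans kL.
have [x1 x1'] : -1 < x /\ x < 1 by split; clear -dp1 dm1 xc xd k0 ksg kE sgE; lra.
have [eps epsE] : {eps | eps = L - k} by exists (L - k).
have eps0 : 0 <= eps by rewrite epsE subr_ge0.
(* [x + L - c = eps + d], and replacing [c] by the mean costs at most [d / 80], so [N ^+ 2] bounds
   the distance from [A] to the mean. *)
set N := Num.sqrt (eps + 81 / 80 * d).
have Np : 0 < eps + 81 / 80 * d by clear -eps0 k0 ksg dks; lra.
have N0 : 0 < N by rewrite sqrtr_gt0.
have N2 : N ^+ 2 = eps + 81 / 80 * d by rewrite sqr_sqrtr // ltW.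
have shiftL0 : shift_poly al be s (x + L) L = 0.
  transitivity (4 * s ^+ 2 * L ^+ 2 * ((L - k) * (L + sg)) - shift_defect x L); last by rewrite eL subrr.
  by rewrite /shift_poly QE /shift_defect kE sgE; ring.
have main := @bound_of_majorant R al be s d x L N p w Y js s3 x1 x1' L0.
have {}main : w x * p.[x] ^+ 2 * shift_lower al be s (x + L) x <=
    (4 * s ^+ 2 - 1) / 16 * (26 / 25 * N) * (Y 1 - Y (-1)).
  apply: main => //.
  - by clear -Lw; lra.
  - by rewrite N2; clear -hm1 hm2 epsE kE eps0 d0; lra.
  - by rewrite N2; clear -hm1 hm2 epsE kE; lra.
  - by rewrite N2; clear -eps0 d0; lra.
have y0 : 0 <= w x * p.[x] ^+ 2 by apply: mulr_ge0 (js_w0 js x) (sqr_ge0 _).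
rewrite DE.
apply: (@bound_of_shift R s k sg eps L N _ _ (k * sg + eps * (k + sg + eps) / 5)) => //.
- by rewrite epsE addrC subrK.
- by rewrite -dks.
apply: le_trans main; rewrite ler_wpM2l //.
have AL : x + L - x = L by ring.
rewrite /shift_lower AL ler_pM2r ?invr_gt0 ?mulr_gt0 ?sqrtr_gt0 //.
have -> : 4 * potential al be s x - 8 * x * (1 - x ^+ 2) / L + 5 * (1 - x ^+ 2) ^+ 2 / L ^+ 2 =
     4 * s ^+ 2 * (k * sg) + shift_gain x L / L ^+ 2.
  have -> : potential al be s x = s ^+ 2 * (k * sg) - 1 + x ^+ 2 by rewrite -DE -QE; ring.
  by rewrite /shift_gain; field; rewrite gt_eqF.
(* By the choice of [L], [4 * s ^+ 2 * (eps * (k + sg + eps))] is [shift_defect x L / L ^+ 2], and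
   the gain is at least a fifth of the defect. *)
have : 4 * s ^+ 2 * (eps * (k + sg + eps)) / 5 <= shift_gain x L / L ^+ 2.
  rewrite ler_pdivlMr ?exprn_gt0 //.
  have -> : 4 * s ^+ 2 * (eps * (k + sg + eps)) / 5 * L ^+ 2 = shift_defect x L / 5.
    by rewrite -eL epsE; field.
  by clear -EJ; lra.
by clear; lra.
Qed.

(** * The case [al < 1/2] *)

(** At [A = 1] only the [y ^+ 2] term of [shift_poly] survives; the excess [4 - 16 * al ^+ 2] is
    positive for [0 <= al < 1 / 2]. *)
Lemma shift_rate1 (R : realType) (al be s x : R) : x < 1 ->
  shift_rate al be s 1 x = ((4 * s ^+ 2 - 1) * Num.sqrt (1 - x) + (4 - 16 * al ^+ 2) / Num.sqrt (1 - x) ^+ 3) / 16.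
Proof.
move=> x1; have x0 : 0 < 1 - x by rewrite subr_gt0.
rewrite /shift_rate /shift_poly /potential.
have t0 : Num.sqrt (1 - x) != 0 by rewrite gt_eqF // sqrtr_gt0.
have e : 1 - x = Num.sqrt (1 - x) ^+ 2 by rewrite sqr_sqrtr // ltW.
move: e t0; move: (Num.sqrt (1 - x)) => t e t0.
have -> : x = 1 - t ^+ 2 by lra.
by field.
Qed.

(** [(1 - x) * sg] is [D] without its term in [al]. With this [sg], the sum [Dl = 1 - x + sg] does
    not depend on [x] and replaces the width of the interval. *)
Lemma shift_lower1 (R : realType) (al be s x sg : R) : s != 0 -> x < 1 -> sg = 1 + x - 2 * be ^+ 2 / s ^+ 2 ->
  16 * Num.sqrt (1 - x) * shift_lower al be s 1 x =
   4 * s ^+ 2 * ((1 - x) * sg) + (1 + x) * ((4 - 16 * al ^+ 2) / 2 - (1 - x)).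
Proof.
move=> sn x1 ->; have x0 : 0 < 1 - x by rewrite subr_gt0.
have t0 : Num.sqrt (1 - x) != 0 by rewrite gt_eqF // sqrtr_gt0.
by rewrite /shift_lower /potential; field; rewrite sn t0 gt_eqF.
Qed.

Lemma hard_edge_width (R : realType) (al be s Dl : R) : 0 <= al -> 0 <= be -> al + be + 3 <= s ->
  Dl = 2 - 2 * be ^+ 2 / s ^+ 2 -> [/\ 18 <= s ^+ 2 * Dl, 36 <= s ^+ 2 * Dl ^+ 2, 0 < Dl & Dl <= 2].
Proof.
move=> a0 b0 abs DlE.
have s3 : 3 <= s by lra.
have sn : s != 0 by rewrite gt_eqF //; lra.
have bs : be ^+ 2 <= (s - 3) ^+ 2 by apply: sqr_le; lra.
have e : s ^+ 2 * Dl = 2 * (s ^+ 2 - be ^+ 2) by rewrite DlE; field.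
have h1 : 12 * s - 18 <= s ^+ 2 * Dl by lra.
have h2 : 6 <= s * Dl.
  rewrite -(@ler_pM2l _ s); last lra.
  by rewrite mulrA -expr2; lra.
split; first lra.
- by have := @sqr_le _ 6 (s * Dl); lra.
- by rewrite -(@pmulr_rgt0 _ s) //; lra.
- have bb : 0 <= be ^+ 2 / s ^+ 2 by rewrite divr_ge0 ?sqr_ge0.
  by rewrite DlE; lra.
Qed.

Lemma hard_edge_mean (R : realType) (al be s Dl : R) : 0 <= al -> al < 1 / 2 -> 0 <= be -> al + be + 3 <= s ->
  Dl = 2 - 2 * be ^+ 2 / s ^+ 2 -> 0 < 1 - jacobi_mean al be s <= (18 / 25) ^+ 2 * Dl.
Proof.
move=> a0 a2 b0 abs DlE.
have [h18 h36 Dl0 Dl2] := hard_edge_width a0 b0 abs DlE.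
have s3 : 3 <= s by lra.
have sn : s != 0 by rewrite gt_eqF //; lra.
have S9 : 3 ^+ 2 <= s ^+ 2 by apply: sqr_le; lra.
have bs : be ^+ 2 <= (s - 3) ^+ 2 by apply: sqr_le; lra.
have e : s ^+ 2 * Dl = 2 * (s ^+ 2 - be ^+ 2) by rewrite DlE; field.
have al4 : al ^+ 2 <= 1 / 4 by have := @sqr_le _ al (1/2); lra.
have S1 : 0 < s ^+ 2 - 1 by lra.
rewrite /jacobi_mean (_ : 1 - _ = (s ^+ 2 - 1 - be ^+ 2 + al ^+ 2) / (s ^+ 2 - 1)); last by field; rewrite gt_eqF.
apply/andP; split; first by rewrite divr_gt0 //; have := sqr_ge0 al; lra.
by rewrite ler_pdivrMr //; lra.
Qed.

(** Scale-free closing step: [S] and [Dl] cancel and a numerical inequality remains. The [1 / 18]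
    comes from absorbing [- 2] by [18 <= S * Dl]. *)
Lemma hard_edge_final (R : realType) (S Dl sg c C f e : R) : 18 <= S * Dl -> 0 < Dl -> 0 < S -> 0 <= C ->
  C ^+ 2 <= 16 * S ^+ 2 * c * Dl -> f * Dl <= sg -> 1 / 4 <= f -> 0 <= e -> e <= 1 ->
  20 * e * c < 9 * (2 * f - 1 / 18) ^+ 2 ->
  5 * (e * Dl) * C ^+ 2 < 9 * (4 * S * sg - 2) ^+ 2.
Proof.
move=> SD D0 S0 C0 hC fs f4 e0 e1 fin.
set t := S * Dl in SD.
have h1 : 2 * t * (2 * f - 1 / 18) <= 4 * S * sg - 2.
  have : S * (f * Dl) <= S * sg by rewrite ler_pM2l.
  rewrite /t in SD *; lra.
have h2 : (2 * t * (2 * f - 1 / 18)) ^+ 2 <= (4 * S * sg - 2) ^+ 2.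
  by apply: sqr_le => //; rewrite mulr_ge0 //; lra.
apply: (@lt_le_trans _ _ (9 * (2 * t * (2 * f - 1 / 18)) ^+ 2)); last by rewrite ler_pM2l.
have eD : 0 <= 5 * (e * Dl) by rewrite !mulr_ge0 //; exact: ltW.
apply: (le_lt_trans (ler_wpM2l eD hC)).
have t2 : 0 < 4 * t ^+ 2 by rewrite mulr_gt0 // exprn_gt0 //; lra.
rewrite (_ : 5 * _ * _ = 4 * t ^+ 2 * (20 * e * c)); last by rewrite /t; ring.
rewrite (_ : 9 * _ = 4 * t ^+ 2 * (9 * (2 * f - 1 / 18) ^+ 2)); last by ring.
by rewrite ltr_pM2l.
Qed.

(** Both summands are compared with [s ^+ 2 * Num.sqrt Dl]; for the second one,
    [36 <= s ^+ 2 * Dl ^+ 2] converts the inverse cube. *)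
Lemma hard_edge_const (R : realType) (s Dl N t rho : R) : 0 < Dl -> 36 <= s ^+ 2 * Dl ^+ 2 -> 0 < N ->
  N ^+ 2 <= (18 / 25) ^+ 2 * Dl -> 0 < rho -> 0 < t -> rho ^+ 2 * Dl <= t ^+ 2 ->
  (4 * s ^+ 2 * N + 4 / t ^+ 3) ^+ 2 <= 16 * (s ^+ 2) ^+ 2 * (18 / 25 + 1 / (36 * rho ^+ 3)) ^+ 2 * Dl.
Proof.
move=> D0 h36 N0 hN rho0 t0 ht.
set r := Num.sqrt Dl; have r0 : 0 < r by rewrite sqrtr_gt0.
have r2 : r ^+ 2 = Dl by rewrite sqr_sqrtr // ltW.
rewrite -r2 in hN ht h36 *.
have hN' : N <= 18 / 25 * r by apply: le_of_sqr; [rewrite mulr_ge0 // ltW | rewrite exprMn].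
have ht' : rho * r <= t by apply: le_of_sqr; [exact: ltW | rewrite exprMn].
have rr : 0 < rho * r by rewrite mulr_gt0.
have h3 : 4 / t ^+ 3 <= 4 * s ^+ 2 * (1 / (36 * rho ^+ 3) * r).
  apply: (@le_trans _ _ (4 / (rho * r) ^+ 3)).
    by rewrite ler_pM2l // lef_pV2 ?posrE ?exprn_gt0 // lerXn2r // nnegrE ltW.
  have r4 : 0 < 4 / (36 * rho ^+ 3 * r ^+ 3) by rewrite divr_gt0 // !mulr_gt0 ?exprn_gt0.
  have -> : 4 / (rho * r) ^+ 3 = 4 / (36 * rho ^+ 3 * r ^+ 3) * 36 by field; rewrite !gt_eqF.
  have -> : 4 * s ^+ 2 * (1 / (36 * rho ^+ 3) * r) = 4 / (36 * rho ^+ 3 * r ^+ 3) * (s ^+ 2 * (r ^+ 2) ^+ 2) by field; rewrite !gt_eqF.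
  by rewrite ler_pM2l.
have -> : 16 * (s ^+ 2) ^+ 2 * (18 / 25 + 1 / (36 * rho ^+ 3)) ^+ 2 * r ^+ 2 =
   (4 * s ^+ 2 * (18 / 25 * r + 1 / (36 * rho ^+ 3) * r)) ^+ 2 by ring.
have s20 := sqr_ge0 s.
apply: sqr_le.
  apply: addr_ge0; first by rewrite mulr_ge0 ?(ltW N0) // mulr_ge0.
  by rewrite divr_ge0 // exprn_ge0 // ltW.
rewrite mulrDr lerD // ler_wpM2l // mulr_ge0 //.
Qed.

(** For [A = 1] the tangent line is nonnegative on [[-1, 1]], so the quadratic coefficient can be
    [0]. *)
Lemma hard_edge_quad (R : realType) (al be s N e y : R) : N != 0 -> N ^+ 2 = 1 - jacobi_mean al be s ->
  jacobi_quad al be s ((4 * s ^+ 2 - 1) / 16 * N + e) (- ((4 * s ^+ 2 - 1) / 16) / (2 * N)) 0 y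
   = (4 * s ^+ 2 - 1) / 16 * (N / 2 + (1 - y) / (2 * N)) + e.
Proof.
move=> Nn N2; rewrite /jacobi_quad.
have -> : jacobi_mean al be s = 1 - N ^+ 2 by lra.
by field.
Qed.

(** [sg <= 3 * (1 - x)] means [Dl / 4 <= 1 - x]: far enough from [1] to bound the excess left of [x]
    by its value at [x]. *)
Lemma bound_hard_bulk (R : realType) (al be s x sg : R) p w Y :
  jacobi_system al be s p w Y -> 0 <= al -> al < 1 / 2 -> 0 <= be -> al + be + 3 <= s ->
  (be ^+ 2 - al ^+ 2) / s ^+ 2 <= x ->
  sg = 1 + x - 2 * be ^+ 2 / s ^+ 2 -> sg <= 3 * (1 - x) -> x < 1 -> -1 < x ->
  0 < Y 1 - Y (-1) ->
  5 * ((1 - x) * sg) * (w x * p.[x] ^+ 2) ^+ 2 < 9 * (Y 1 - Y (-1)) ^+ 2.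
Proof.
move=> js a0 a2 b0 abs xc sgE sg3 x1 x1' I0.
set Dl := 2 - 2 * be ^+ 2 / s ^+ 2.
have [h18 h36 D0 D2] := hard_edge_width a0 b0 abs (erefl Dl).
have /andP[v1 v2] := hard_edge_mean a0 a2 b0 abs (erefl Dl).
set N := Num.sqrt (1 - jacobi_mean al be s).
have N0 : 0 < N by rewrite sqrtr_gt0.
have N2 : N ^+ 2 = 1 - jacobi_mean al be s by rewrite sqr_sqrtr // ltW.
set t := Num.sqrt (1 - x); have t0 : 0 < t by rewrite sqrtr_gt0 subr_gt0.
have t2 : t ^+ 2 = 1 - x by rewrite sqr_sqrtr // subr_ge0 ltW.
have s3 : 3 <= s by clear -a0 b0 abs; lra.
have sn : s != 0 by rewrite gt_eqF //; clear -s3; lra.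
have S9 : 3 ^+ 2 <= s ^+ 2 by apply: sqr_le.
have al4 : al ^+ 2 <= 1 / 4 by have := @sqr_le _ al (1/2); clear -a0 a2; lra.
have al0 := sqr_ge0 al.
have Gg0 : 0 <= 4 - 16 * al ^+ 2 by clear -al4; lra.
have Ls : 1 - x + sg = Dl by rewrite sgE /Dl; ring.
have f1 : 35 / 72 * Dl <= sg.
  have e1 : sg - Dl / 2 = x - (be ^+ 2 - al ^+ 2) / s ^+ 2 - al ^+ 2 / s ^+ 2 by rewrite sgE /Dl; field.
  have e2 : al ^+ 2 / s ^+ 2 <= Dl / 72.
    by rewrite ler_pdivrMr; clear -S9 al4 h18; lra.
  by clear -e1 e2 xc; lra.
set C := 4 * s ^+ 2 * N + 4 / t ^+ 3.
set y := w x * p.[x] ^+ 2; set I := Y 1 - Y (-1) in I0 *.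
have y0 : 0 <= y by apply: mulr_ge0 (js_w0 js x) (sqr_ge0 _).
have main : y * shift_lower al be s 1 x <=
   ((4 * s ^+ 2 - 1) / 16 * N + (4 - 16 * al ^+ 2) / t ^+ 3 / 16) * I.
  apply: (@shifted_compare R al be s 1 x _ (- ((4 * s ^+ 2 - 1) / 16) / (2 * N)) 0 p w Y js) => //.
  - by clear -s3; lra.
  - by rewrite x1'.
  - move=> z /andP[z1 zx]; have z01 := lt_trans zx x1.
    rewrite hard_edge_quad ?gt_eqF // shift_rate1 //.
    have z0 : 0 < 1 - z by rewrite subr_gt0.
    have tz : 0 < Num.sqrt (1 - z) by rewrite sqrtr_gt0.
    have h1 := sqrt_le_line N0 (ltW z0).
    have h2 : (4 - 16 * al ^+ 2) / Num.sqrt (1 - z) ^+ 3 <= (4 - 16 * al ^+ 2) / t ^+ 3.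
      rewrite ler_wpM2l // lef_pV2 ?posrE ?exprn_gt0 //.
      by rewrite lerXn2r ?nnegrE ?sqrtr_ge0 // ler_wsqrtr // lerD2l lerN2 ltW.
    have h3 : (4 * s ^+ 2 - 1) * Num.sqrt (1 - z) <= (4 * s ^+ 2 - 1) * (N / 2 + (1 - z) / (2 * N)).
      by rewrite ler_wpM2l //; clear -S9; lra.
    by clear -h2 h3; lra.
  - move=> z /andP[z1 z2]; rewrite hard_edge_quad ?gt_eqF //.
    apply: addr_ge0; last by rewrite !divr_ge0 // exprn_ge0 // ltW.
    apply: mulr_ge0; first by clear -S9; lra.
    by apply: addr_ge0; rewrite divr_ge0 ?mulr_ge0 ?(ltW N0) ?subr_ge0 // ltW.
have B1 : 0 < 4 * s ^+ 2 * sg - 2.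
  have : s ^+ 2 * (35 / 72 * Dl) <= s ^+ 2 * sg by rewrite ler_wpM2l ?sqr_ge0.
  by clear -h18; lra.
have {main} main : y * t * (4 * s ^+ 2 * sg - 2) <= C * I.
  have t16 : 0 <= 16 * t by rewrite mulr_ge0 // ltW.
  have := ler_wpM2l t16 main.
  rewrite mulrCA (shift_lower1 _ sn x1 sgE) => m1.
  rewrite -(ler_pM2l t0).
  apply: (@le_trans _ _ (y * (4 * s ^+ 2 * ((1 - x) * sg) + (1 + x) * ((4 - 16 * al ^+ 2) / 2 - (1 - x))))).
    rewrite (_ : t * _ = y * ((1 - x) * (4 * s ^+ 2 * sg - 2))); last by rewrite -t2; ring.
    rewrite ler_wpM2l //.
    have : 0 <= (1 + x) * (4 - 16 * al ^+ 2) by rewrite mulr_ge0 //; clear -x1'; lra.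
    have : 0 <= (1 - x) * (1 - x) by rewrite -expr2 sqr_ge0.
    by clear; lra.
  apply: (le_trans m1).
  rewrite (_ : 16 * t * (_ * I) = t * (((4 * s ^+ 2 - 1) * N + (4 - 16 * al ^+ 2) / t ^+ 3) * I)); last by field; rewrite gt_eqF.
  rewrite ler_pM2l // ler_pM2r // /C lerD //.
    by rewrite ler_pM2r // gerBl.
  by rewrite ler_pM2r ?invr_gt0 ?exprn_gt0 //; clear -al0; lra.
have {}main := sqr_le (_ : 0 <= y * t * (4 * s ^+ 2 * sg - 2)) main.
have {}main : (y * t * (4 * s ^+ 2 * sg - 2)) ^+ 2 <= (C * I) ^+ 2.
  by apply: main; apply: mulr_ge0 (ltW B1); apply: mulr_ge0 y0 (ltW t0).
have C0 : 0 <= C.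
  apply: addr_ge0; last by rewrite divr_ge0 // exprn_ge0 // ltW.
  by apply: mulr_ge0 (ltW N0); apply: mulr_ge0 (sqr_ge0 _).
have N2' : N ^+ 2 <= (18 / 25) ^+ 2 * Dl by rewrite N2.
have sgD : sg / Dl * Dl = sg by field; rewrite gt_eqF.
have fin : 5 * sg * C ^+ 2 < 9 * (4 * s ^+ 2 * sg - 2) ^+ 2.
  have fl : 35 / 72 <= sg / Dl by rewrite ler_pdivlMr.
  have fu : sg / Dl <= 1 by rewrite ler_pdivrMr // mul1r -Ls lerDr subr_ge0 ltW.
  have f4 : 1 / 4 <= sg / Dl by clear -fl; lra.
  have f0 : 0 <= sg / Dl by clear -fl; lra.
  have S0 : 0 < s ^+ 2 by clear -S9; lra.
  rewrite -[X in 5 * X]sgD.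
  (* If [(1 - x) / Dl] is at least [(3 / 5) ^+ 2], the bound [35 / 72] on [sg / Dl] suffices.
     Otherwise only [rho = 1 / 2] is available, but [sg / Dl] exceeds [16 / 25]. *)
  have [L36|L36] := lerP (9 / 25 * Dl) (1 - x).
    have rho0 : 0 < 3 / 5 :> R by clear; lra.
    have hC := hard_edge_const (rho := 3 / 5) D0 h36 N0 N2' rho0 t0.
    have {}hC : C ^+ 2 <= 16 * (s ^+ 2) ^+ 2 * (18 / 25 + 1 / (36 * (3 / 5) ^+ 3)) ^+ 2 * Dl.
      by apply: hC; rewrite t2; clear -L36; lra.
    apply: (hard_edge_final h18 D0 S0 C0 hC _ f4 f0 fu); first by rewrite sgD.
    by have := sqr_ge0 (sg / Dl - 35 / 72); clear -fl; lra.
  have rho0 : 0 < 1 / 2 :> R by clear; lra.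
  have hC := hard_edge_const (rho := 1 / 2) D0 h36 N0 N2' rho0 t0.
  have {}hC : C ^+ 2 <= 16 * (s ^+ 2) ^+ 2 * (18 / 25 + 1 / (36 * (1 / 2) ^+ 3)) ^+ 2 * Dl.
    by apply: hC; rewrite t2; clear -sg3 Ls; lra.
  apply: (hard_edge_final h18 D0 S0 C0 hC _ f4 f0 fu); first by rewrite sgD.
  have fl' : 16 / 25 <= sg / Dl by rewrite ler_pdivlMr //; clear -L36 Ls; lra.
  by have := sqr_ge0 (sg / Dl - 16 / 25); clear -fl'; lra.
rewrite -t2 -(ltr_pM2r (exprn_gt0 2 B1)).
apply: (@le_lt_trans _ _ (5 * sg * C ^+ 2 * I ^+ 2)).
  have -> : 5 * (t ^+ 2 * sg) * y ^+ 2 * (4 * s ^+ 2 * sg - 2) ^+ 2 = 5 * sg * (y * t * (4 * s ^+ 2 * sg - 2)) ^+ 2 by ring.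
  have -> : 5 * sg * C ^+ 2 * I ^+ 2 = 5 * sg * (C * I) ^+ 2 by ring.
  by rewrite ler_wpM2l // mulr_ge0 // (le_trans _ f1) // mulr_ge0 ?(ltW D0) //; clear; lra.
have -> : 9 * I ^+ 2 * (4 * s ^+ 2 * sg - 2) ^+ 2 = 9 * (4 * s ^+ 2 * sg - 2) ^+ 2 * I ^+ 2 by ring.
by rewrite ltr_pM2r // exprn_gt0.
Qed.

(** Left of [xm] the excess is bounded by its value at [xm]. On [[xm, x0]] maximality gives
    [y / (1 - z)^(3/2) <= m / (1 - z)^2], which [E] integrates. As [m] is attained at [x0], the term
    [m / (1 - x0)] is offset by the matching part of [shift_lower], up to a remainder absorbed by
    the term in [(1 - xm)^-1]. *)
Lemma hard_edge_max (R : realType) (al be s N xm x0 m : R) p w Y :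
  jacobi_system al be s p w Y -> 0 <= al -> al < 1 / 2 -> 2 < s -> 0 < N -> N ^+ 2 = 1 - jacobi_mean al be s ->
  -1 < xm -> 1 / 2 <= xm -> xm <= x0 -> x0 < 1 -> m = Num.sqrt (1 - x0) * (w x0 * p.[x0] ^+ 2) ->
  (forall z, xm <= z <= 1 -> Num.sqrt (1 - z) * (w z * p.[z] ^+ 2) <= m) ->
  0 < Y 1 - Y (-1) ->
  m * (4 * s ^+ 2 * (1 + x0 - 2 * be ^+ 2 / s ^+ 2) - 2)
    <= (4 * s ^+ 2 * N + 4 / Num.sqrt (1 - xm) ^+ 3) * (Y 1 - Y (-1)).
Proof.
move=> js a0 a2 s2 N0 N2 xm1 xm2 xmx x01 mE mmax I0.
have sn : s != 0 by rewrite gt_eqF //; clear -s2; lra.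
have S4 : 2 ^+ 2 < s ^+ 2 by apply: sqr_lt => //; clear; lra.
have al4 : al ^+ 2 <= 1 / 4 by have := @sqr_le _ al (1/2); clear -a0 a2; lra.
have al0 := sqr_ge0 al.
set Gg := 4 - 16 * al ^+ 2.
have Gg0 : 0 <= Gg by rewrite /Gg; clear -al4; lra.
have Gg4 : Gg <= 4 by rewrite /Gg; clear -al0; lra.
set K := (4 * s ^+ 2 - 1) / 16.
have K0 : 0 <= K by rewrite /K; clear -S4; lra.
set tm := Num.sqrt (1 - xm).
have tm0 : 0 < tm by rewrite sqrtr_gt0 subr_gt0 (le_lt_trans xmx).
set t0 := Num.sqrt (1 - x0) in mE.
have t00 : 0 < t0 by rewrite sqrtr_gt0 subr_gt0.
have t02 : t0 ^+ 2 = 1 - x0 by rewrite sqr_sqrtr // subr_ge0 ltW.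
have y_ge0 z : 0 <= w z * p.[z] ^+ 2 by apply: mulr_ge0 (js_w0 js z) (sqr_ge0 _).
have xm01 : xm < 1 by exact: le_lt_trans x01.
have m0 : 0 <= m by rewrite mE mulr_ge0 // ltW.
set q0 := K * N + Gg / tm ^+ 3 / 16; set q1 := - K / (2 * N).
have [F [F0 Fc Fd Fl]] := shifted_functional 1 js.
have [G [Gc Gd GI]] := quadratic_antiderivative q0 q1 0 js s2.
have quadE z : jacobi_quad al be s q0 q1 0 z = K * (N / 2 + (1 - z) / (2 * N)) + Gg / tm ^+ 3 / 16.
  by rewrite hard_edge_quad ?gt_eqF.
have e_ge0 : 0 <= Gg / tm ^+ 3 / 16 by rewrite !divr_ge0 // exprn_ge0 // ltW.
have coefE z : z < 1 -> shift_rate al be s 1 z = K * Num.sqrt (1 - z) + Gg / Num.sqrt (1 - z) ^+ 3 / 16.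
  by move=> z1; rewrite shift_rate1 // /K /Gg; field; rewrite gt_eqF // sqrtr_gt0 subr_gt0.
have line z : z < 1 -> K * Num.sqrt (1 - z) <= K * (N / 2 + (1 - z) / (2 * N)).
  by move=> z1; rewrite ler_wpM2l // sqrt_le_line // subr_ge0 ltW.
have sub a b : -1 <= a -> b <= 1 -> {within `[a, b], continuous G}.
  move=> a1 b1; apply: continuous_subspaceW Gc => z /=; rewrite !in_itv /= => /andP[az zb].
  by rewrite (le_trans a1 az) (le_trans zb b1).
have subF a b : -1 <= a -> b < 1 -> {within `[a, b], continuous F}.
  move=> a1 b1; apply: continuous_subspaceW (Fc b (ltW b1) b1) => z /=; rewrite !in_itv /= => /andP[az zb].
  by rewrite (le_trans a1 az) zb.
have h1 : (G - F) (-1) <= (G - F) xm.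
  apply: (is_derive_ge0_le (df := fun z => w z * p.[z] ^+ 2 * jacobi_quad al be s q0 q1 0 z
        - w z * p.[z] ^+ 2 * shift_rate al be s 1 z)).
  - exact: ltW.
  - by apply: within_continuousB; [apply: sub|apply: subF] => //; exact: ltW.
  - move=> z /andP[z1 zx]; have z01 := lt_trans zx xm01.
    have z11 : -1 < z < 1 by rewrite z1.
    by apply: is_deriveB; [exact: Gd | exact: Fd].
  - move=> z /andP[z1 zx]; have z01 := lt_trans zx xm01.
    rewrite -mulrBr mulr_ge0 // subr_ge0 quadE coefE // lerD ?line //.
    have tz : 0 < Num.sqrt (1 - z) by rewrite sqrtr_gt0 subr_gt0.
    rewrite ler_pM2r ?invr_gt0 // ler_wpM2l // lef_pV2 ?posrE ?exprn_gt0 //.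
    by rewrite lerXn2r ?nnegrE ?sqrtr_ge0 // ler_wsqrtr // lerD2l lerN2 ltW.
set E : R -> R := cst (Gg * m / 16) * (fun z => ((cst 1 - id : R -> R) z)^-1).
have DE (z : R) : z < 1 -> is_derive z 1 E (Gg * m / 16 / (1 - z) ^+ 2).
  move=> z1; have zn : (cst 1 - id : R -> R) z != 0 by rewrite !fctE gt_eqF // subr_gt0.
  have D1 : is_derive z 1 (cst 1 - id : R -> R) (-1) by apply: is_derive_eq; rewrite sub0r.
  have H := is_deriveM (is_derive_cst (Gg * m / 16) z 1) (is_deriveV zn D1).
  rewrite /E; apply: (is_derive_eq H); rewrite !fctE /cst /GRing.scale /=.
  by field; rewrite gt_eqF // subr_gt0.
have h2 : (G - F + E) xm <= (G - F + E) x0.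
  apply: (is_derive_ge0_le (df := fun z => w z * p.[z] ^+ 2 * jacobi_quad al be s q0 q1 0 z
        - w z * p.[z] ^+ 2 * shift_rate al be s 1 z + Gg * m / 16 / (1 - z) ^+ 2)).
  - by [].
  - apply: within_continuousD.
      by apply: within_continuousB; [apply: sub|apply: subF] => //; exact: ltW.
    apply: derivable_within_continuous => z; rewrite in_itv /= => /andP[_ zx].
    by have [] := DE z (le_lt_trans zx x01).
  - move=> z /andP[z1 zx]; have z01 := lt_trans zx x01.
    have z11 : -1 < z < 1 by rewrite (lt_trans xm1 z1).
    apply: is_deriveD; last exact: DE.
    by apply: is_deriveB; [exact: Gd | exact: Fd].
  - move=> z /andP[z1 zx]; have z01 := lt_trans zx x01.
    rewrite -mulrBr quadE coefE //.
    set t := Num.sqrt (1 - z); have tt : 0 < t by rewrite sqrtr_gt0 subr_gt0.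
    have t2 : 1 - z = t ^+ 2 by rewrite sqr_sqrtr // subr_ge0 ltW.
    have zin : xm <= z <= 1 by rewrite !ltW.
    have ym := mmax z zin; rewrite -/t in ym.
    have hl := line z z01; rewrite -/t in hl.
    set yz := w z * p.[z] ^+ 2 in ym *.
    have yz0 : 0 <= yz by exact: y_ge0.
    have k1 : 0 <= yz * (K * (N / 2 + (1 - z) / (2 * N)) - K * t + Gg / tm ^+ 3 / 16).
      by rewrite mulr_ge0 // addr_ge0 // subr_ge0.
    have k2 : yz * (Gg / t ^+ 3 / 16) <= Gg * m / 16 / (1 - z) ^+ 2.
      rewrite t2 (_ : yz * _ = Gg / 16 / t ^+ 4 * (t * yz)); last by field; rewrite gt_eqF.
      rewrite (_ : Gg * m / 16 / _ = Gg / 16 / t ^+ 4 * m); last by field; rewrite gt_eqF.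
      by rewrite ler_wpM2l // !divr_ge0 // exprn_ge0 // ltW.
    by clear -k1 k2; lra.
have h3 : G x0 <= G 1.
  apply: (is_derive_ge0_le (df := fun z => w z * p.[z] ^+ 2 * jacobi_quad al be s q0 q1 0 z)).
  - exact: ltW.
  - by apply: sub => //; exact: ltW (lt_le_trans xm1 xmx).
  - by move=> z /andP[xz z1]; apply: Gd; rewrite z1 (lt_trans _ xz) ?(lt_le_trans xm1).
  - move=> z /andP[xz z1]; rewrite mulr_ge0 // quadE addr_ge0 // mulr_ge0 //.
    by apply: addr_ge0; rewrite divr_ge0 ?mulr_ge0 ?(ltW N0) ?subr_ge0 // ltW.
have low := Fl x0 x01.
set I := Y 1 - Y (-1) in GI I0 *; set y0 := w x0 * p.[x0] ^+ 2 in mE low *.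
have {h1 h2 h3 GI low} : y0 * shift_lower al be s 1 x0 <= q0 * I + Gg * m / 16 * ((1 - x0)^-1 - (1 - xm)^-1).
  apply: (le_trans low); move: h1 h2 h3; rewrite -GI /E !fctE /cst F0.
  by clear; lra.
move=> main.
have t16 : 0 <= 16 * t0 by rewrite mulr_ge0 // ltW.
have := ler_wpM2l t16 main.
rewrite mulrCA (shift_lower1 al sn x01 (erefl (1 + x0 - 2 * be ^+ 2 / s ^+ 2))) -/Gg.
set sg := 1 + x0 - _.
have Lm : 2 <= (1 - xm)^-1 by rewrite -[leLHS]invrK lef_pV2 ?posrE ?subr_gt0 //; clear -xm2; lra.
rewrite (_ : 16 * t0 * (q0 * I + _) = t0 * (((4 * s ^+ 2 - 1) * N + Gg / tm ^+ 3) * I)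
   + Gg * (1 - (1 - x0) * (1 - xm)^-1) * y0); last first.
  by rewrite mE /q0 /K -t02; field; rewrite !gt_eqF // subr_gt0.
move=> {}main.
have y00 : 0 <= y0 by exact: y_ge0.
have {main} main : y0 * ((1 - x0) * (4 * s ^+ 2 * sg - 2)) <= t0 * (((4 * s ^+ 2 - 1) * N + Gg / tm ^+ 3) * I).
  have L0 : 0 <= 1 - x0 by rewrite subr_ge0 ltW.
  have k1 : 0 <= y0 * ((1 - x0) * (1 - x0)) by rewrite mulr_ge0 // mulr_ge0.
  have k2 : 0 <= y0 * (Gg * ((1 - x0) * ((1 - xm)^-1 - 1 / 2))).
    apply: mulr_ge0 => //; apply: mulr_ge0 => //; apply: mulr_ge0 => //.
    by clear -Lm; lra.
  by clear -main k1 k2; lra.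
rewrite -(ler_pM2l t00).
rewrite (_ : t0 * (m * _) = y0 * ((1 - x0) * (4 * s ^+ 2 * sg - 2))); last by rewrite mE -t02; ring.
apply: (le_trans main); rewrite ler_pM2l // ler_pM2r // lerD //.
  by rewrite ler_pM2r // gerBl.
by rewrite ler_pM2r ?invr_gt0 ?exprn_gt0.
Qed.

Lemma bound_right_lt_half (R : realType) (al be s d x : R) p w Y :
  jacobi_system al be s p w Y -> 0 <= al -> al < 1 / 2 -> 0 <= be -> al + be + 3 <= s -> 0 <= d ->
  (s ^+ 2 * d) ^+ 2 = (s ^+ 2 - (al + be) ^+ 2) * (s ^+ 2 - (al - be) ^+ 2) ->
  (be ^+ 2 - al ^+ 2) / s ^+ 2 <= x -> x < (be ^+ 2 - al ^+ 2) / s ^+ 2 + d ->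
  0 < Y 1 - Y (-1) ->
  5 * (d ^+ 2 - (x - (be ^+ 2 - al ^+ 2) / s ^+ 2) ^+ 2) * (w x * p.[x] ^+ 2) ^+ 2
    < 9 * (Y 1 - Y (-1)) ^+ 2.
Proof.
move=> js a0 a2 b0 abs d0 e; set c0 := (_ - _) / _ => xc xd I0.
have s3 : 3 <= s by clear -a0 b0 abs; lra.
have sn : s != 0 by rewrite gt_eqF //; clear -s3; lra.
have S0 : 0 < s ^+ 2 by rewrite exprn_gt0 //; clear -s3; lra.
have QE y := potential_halfwidth y sn e; rewrite -/c0 in QE.
set D := d ^+ 2 - (x - c0) ^+ 2.
have D0 : 0 < D.
  have : 0 < (c0 + d - x) * (x - c0 + d) by rewrite mulr_gt0 //; clear -xc xd; lra.
  by rewrite /D; clear; lra.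
have [_ dp1 dm1 _] := jacobi_edges a0 b0 abs d0 e; rewrite -/c0 in dp1 dm1.
have x1 : x < 1 by exact: lt_le_trans dp1.
have x1' : -1 < x by clear -dm1 xc xd; lra.
set sg := 1 + x - 2 * be ^+ 2 / s ^+ 2.
have Dsg : D <= (1 - x) * sg.
  rewrite -(ler_pM2l S0) -QE /potential.
  have -> : s ^+ 2 * ((1 - x) * sg) = s ^+ 2 * (1 - x ^+ 2) - 2 * be ^+ 2 * (1 - x) by rewrite /sg; field.
  have : 0 <= al ^+ 2 * (1 + x) by rewrite mulr_ge0 ?sqr_ge0 //; clear -x1'; lra.
  by clear; lra.
apply: (@le_lt_trans _ _ (5 * ((1 - x) * sg) * (w x * p.[x] ^+ 2) ^+ 2)).
  by rewrite ler_wpM2r ?sqr_ge0 // ler_pM2l.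
have [h|h] := lerP sg (3 * (1 - x)).
  exact: (bound_hard_bulk js).
set Dl := 2 - 2 * be ^+ 2 / s ^+ 2.
have [h18 h36 Dl0 Dl2] := hard_edge_width a0 b0 abs (erefl Dl).
have /andP[v1 v2] := hard_edge_mean a0 a2 b0 abs (erefl Dl).
set N := Num.sqrt (1 - jacobi_mean al be s).
have N0 : 0 < N by rewrite sqrtr_gt0.
have N2 : N ^+ 2 = 1 - jacobi_mean al be s by rewrite sqr_sqrtr // ltW.
have Ls : 1 - x + sg = Dl by rewrite /sg /Dl; ring.
(* Here [1 - x < Dl / 4], so [x] lies in [[xm, 1]]. With [m] the maximum of [g] there, the left-hand
   side [5 * sg * g x ^+ 2] is at most [5 * Dl * m ^+ 2]. *)
set xm := 1 - Dl / 4.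
have xmx : xm <= x by rewrite /xm; clear -h Ls; lra.
have xm12 : 1 / 2 <= xm by rewrite /xm; clear -Dl2; lra.
set g : R -> R := (Num.sqrt \o (cst 1 - id : R -> R)) * (w * horner (p ^+ 2)).
have gE z : g z = Num.sqrt (1 - z) * (w z * p.[z] ^+ 2) by rewrite /g !fctE /= horner_exp.
have gc : {within `[xm, 1], continuous g}.
  apply: within_continuousM.
    apply: continuous_subspaceT => z; apply: continuous_comp; last exact: sqrt_continuous.
    by apply: cvgB; [exact: cvg_cst | exact: cvg_id].
  apply: within_continuousM.
    apply: continuous_subspaceW (js_wc js) => z /=; rewrite !in_itv /= => /andP[z1 ->].
    by rewrite andbT (le_trans _ z1) // (le_trans _ xm12) //; clear; lra.
  by apply: continuous_subspaceT => z; exact: continuous_horner.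
have xm1 : xm <= 1 by rewrite /xm; clear -Dl0; lra.
have [x0] := EVT_max xm1 gc.
rewrite in_itv /= => /andP[xmx0 x01] gmax.
set m := g x0.
have m0 : 0 <= m.
  by rewrite /m gE mulr_ge0 ?sqrtr_ge0 //; apply: mulr_ge0 (js_w0 js x0) (sqr_ge0 _).
set tm := Num.sqrt (1 - xm).
have tm0 : 0 < tm by rewrite sqrtr_gt0 /xm; clear -Dl0; lra.
have tm2 : tm ^+ 2 = Dl / 4 by rewrite sqr_sqrtr /xm; clear -Dl0; lra.
set C := 4 * s ^+ 2 * N + 4 / tm ^+ 3.
have C0 : 0 <= C.
  apply: addr_ge0; last by rewrite divr_ge0 // exprn_ge0 // ltW.
  by apply: mulr_ge0 (ltW N0); apply: mulr_ge0 (ltW S0).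
set sg0 := 1 + x0 - 2 * be ^+ 2 / s ^+ 2.
set I := Y 1 - Y (-1) in I0 *.
have main : m * (4 * s ^+ 2 * sg0 - 2) <= C * I.
  (* A maximum attained at [1] forces [m = 0], since [g] vanishes there. *)
  move: x01; rewrite le_eqVlt => /orP[/eqP x0E|x01].
    rewrite (_ : m = 0) ?mul0r; first by rewrite mulr_ge0 // ltW.
    by rewrite /m gE x0E subrr sqrtr0 mul0r.
  apply: (hard_edge_max js a0 a2 _ N0 N2 _ xm12 xmx0 x01 _ _ I0); rewrite -?gE //.
  - by clear -s3; lra.
  - by clear -xm12; lra.
  by move=> z hz; rewrite -gE gmax // in_itv.
have sg0l : 3 / 4 * Dl <= sg0 by move: xmx0; rewrite /xm /sg0 /Dl; clear; lra.
rewrite -N2 in v2.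
have rho0 : 0 < 1 / 2 :> R by clear; lra.
have hC := hard_edge_const (rho := 1 / 2) Dl0 h36 N0 v2 rho0 tm0.
have {}hC : C ^+ 2 <= 16 * (s ^+ 2) ^+ 2 * (18 / 25 + 1 / (36 * (1 / 2) ^+ 3)) ^+ 2 * Dl.
  by apply: hC; rewrite tm2; clear; lra.
have fin : 5 * (1 * Dl) * C ^+ 2 < 9 * (4 * s ^+ 2 * sg0 - 2) ^+ 2.
  by apply: (hard_edge_final (f := 3 / 4) h18 Dl0 S0 C0 hC) => //; clear; lra.
have B1 : 0 < 4 * s ^+ 2 * sg0 - 2.
  have : s ^+ 2 * (3 / 4 * Dl) <= s ^+ 2 * sg0 by rewrite ler_pM2l.
  by clear -h18; lra.
have {}main := sqr_le (mulr_ge0 m0 (ltW B1)) main.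
apply: (@le_lt_trans _ _ (5 * Dl * m ^+ 2)).
  have -> : 5 * ((1 - x) * sg) * (w x * p.[x] ^+ 2) ^+ 2 = 5 * sg * g x ^+ 2.
    have t2 : Num.sqrt (1 - x) ^+ 2 = 1 - x by rewrite sqr_sqrtr // subr_ge0 ltW.
    by rewrite gE -[in LHS]t2; ring.
  apply: ler_pM; rewrite ?sqr_ge0 //.
  - by clear -h x1; lra.
  - by clear -Ls x1; lra.
  apply: sqr_le; last by apply: gmax; rewrite in_itv /= xmx ltW.
  by rewrite gE mulr_ge0 ?sqrtr_ge0 //; apply: mulr_ge0 (js_w0 js x) (sqr_ge0 _).
rewrite -(ltr_pM2r (exprn_gt0 2 B1)).
have -> : 5 * Dl * m ^+ 2 * (4 * s ^+ 2 * sg0 - 2) ^+ 2 = 5 * Dl * (m * (4 * s ^+ 2 * sg0 - 2)) ^+ 2 by ring.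
have -> : 9 * I ^+ 2 * (4 * s ^+ 2 * sg0 - 2) ^+ 2 = 9 * (4 * s ^+ 2 * sg0 - 2) ^+ 2 * I ^+ 2 by ring.
have D50 : 0 <= 5 * Dl by rewrite mulr_ge0 // ltW.
apply: (le_lt_trans (ler_wpM2l D50 main)).
have -> : 5 * Dl * (C * I) ^+ 2 = 5 * (1 * Dl) * C ^+ 2 * I ^+ 2 by ring.
by rewrite ltr_pM2r // exprn_gt0.
Qed.

Lemma bound_right (R : realType) (al be s d x : R) p w Y :
  jacobi_system al be s p w Y -> 0 <= al -> 0 <= be -> al + be + 3 <= s -> 0 <= d ->
  (s ^+ 2 * d) ^+ 2 = (s ^+ 2 - (al + be) ^+ 2) * (s ^+ 2 - (al - be) ^+ 2) ->
  (be ^+ 2 - al ^+ 2) / s ^+ 2 <= x -> x < (be ^+ 2 - al ^+ 2) / s ^+ 2 + d ->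
  0 < Y 1 - Y (-1) ->
  5 * (d ^+ 2 - (x - (be ^+ 2 - al ^+ 2) / s ^+ 2) ^+ 2) * (w x * p.[x] ^+ 2) ^+ 2
    < 9 * (Y 1 - Y (-1)) ^+ 2.
Proof.
move=> js a0 b0 abs d0 e xc xd I0; have [h|h] := lerP (1 / 2) al.
  exact: (bound_right_ge_half js).
exact: (bound_right_lt_half js).
Qed.

(** * Reflection and conclusion *)

(** The outer sign keeps the reflected [Y] a primitive and preserves the difference of its end
    values. *)
Lemma jacobi_systemN (R : realType) (al be s : R) p w Y : jacobi_system al be s p w Y ->
  jacobi_system be al s (p \Po - 'X) (w \o -%R) (- (Y \o -%R)).
Proof.
move=> js.
have dN (f : R -> R) (df x : R) : is_derive (- x) 1 f df -> is_derive x 1 (f \o -%R) (- df).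
  move=> D; have DN : is_derive x 1 (-%R : R -> R) (-1) by apply: is_derive_eq.
  by apply: (is_derive_eq (is_derive1_comp D DN)); rewrite mulrN1.
have x11 (x : R) : -1 < x < 1 -> -1 < - x < 1 by move=> /andP[? ?]; apply/andP; split; lra.
have cN (f : R -> R) : {within `[-1, 1], continuous f} -> {within `[-1, 1], continuous (f \o -%R)}.
  by move=> cf; apply: within_continuous_compN; rewrite opprK.
split.
- move=> x; have := js_ode js (- x).
  have d1 (q : {poly R}) : (q \Po - 'X)^`()%R = - (q^`()%R \Po - 'X).
    by rewrite deriv_comp derivN derivX mulrN1.
  rewrite d1 derivN d1 opprK hornerN !horner_comp hornerN hornerX => <-.
  by ring.
- by move=> x; exact: js_w0 js (- x).
- by apply: cN; exact: js_wc js.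
- move=> x h; apply: (is_derive_eq (dN _ _ _ (js_wd js (x11 _ h)))).
  by rewrite /= opprK; ring.
- have c1 := cN _ (js_Yc js).
  have -> : - (Y \o -%R) = (cst 0 : R -> R) - (Y \o -%R) by apply/funext => z; rewrite !fctE sub0r.
  apply: within_continuousB => //; apply: continuous_subspaceT => z; exact: cvg_cst.
- move=> x h; apply: (is_derive_eq (is_deriveN (dN _ _ _ (js_Yd js (x11 _ h))))).
  by rewrite opprK horner_comp !hornerE.
Qed.

Lemma jacobi_bound (R : realType) (al be s d x : R) p w Y :
  jacobi_system al be s p w Y -> 0 <= al -> 0 <= be -> al + be + 3 <= s -> 0 <= d ->
  (s ^+ 2 * d) ^+ 2 = (s ^+ 2 - (al + be) ^+ 2) * (s ^+ 2 - (al - be) ^+ 2) ->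
  (be ^+ 2 - al ^+ 2) / s ^+ 2 - d < x < (be ^+ 2 - al ^+ 2) / s ^+ 2 + d ->
  0 < Y 1 - Y (-1) ->
  5 * (d ^+ 2 - (x - (be ^+ 2 - al ^+ 2) / s ^+ 2) ^+ 2) * (w x * p.[x] ^+ 2) ^+ 2
    < 9 * (Y 1 - Y (-1)) ^+ 2.
Proof.
move=> js a0 b0 abs d0 e /andP[xd1 xd2] I0.
have [xc|xc] := lerP ((be ^+ 2 - al ^+ 2) / s ^+ 2) x.
  exact: (bound_right js).
have cE : (al ^+ 2 - be ^+ 2) / s ^+ 2 = - ((be ^+ 2 - al ^+ 2) / s ^+ 2) by ring.
have := @bound_right R be al s d (- x) _ _ _ (jacobi_systemN js) b0 a0.
have YN z : (- (Y \o -%R)) z = - Y (- z) by [].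
have YE : (- (Y \o -%R)) 1 - (- (Y \o -%R)) (-1) = Y 1 - Y (-1) by rewrite !YN !opprK addrC.
rewrite YE cE horner_comp hornerN hornerX /= !opprK.
have -> : (- x + (be ^+ 2 - al ^+ 2) / s ^+ 2) ^+ 2 = (x - (be ^+ 2 - al ^+ 2) / s ^+ 2) ^+ 2 by ring.
have e' : (s ^+ 2 * d) ^+ 2 = (s ^+ 2 - (be + al) ^+ 2) * (s ^+ 2 - (be - al) ^+ 2) by rewrite e; ring.
by apply => //; lra.
Qed.

(** * Jacobi polynomials as an instance of [jacobi_system] *)

Lemma is_derive_powR_onem (R : realType) (a x : R) : x < 1 ->
  is_derive x 1 (fun y => (1 - y) `^ a) (- (a / (1 - x)) * (1 - x) `^ a).
Proof.
move=> x1; have x0 : 0 < 1 - x by rewrite subr_gt0.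
have D1 : is_derive x 1 (cst 1 - id : R -> R) (-1) by apply: is_derive_eq; rewrite sub0r.
have := @is_derive1_comp R (fun z => z `^ a) _ x _ _ (is_derive1_powR a x0) D1.
rewrite /comp /= => D2; apply: (is_derive_eq D2).
rewrite powRB ?powRr1 ?(ltW x0) //; last by rewrite (gt_eqF x0) implybT.
by field; rewrite gt_eqF.
Qed.

(** For [a = 0] the function is constant, since [powR 0 0] is [1]. For [a > 0] it is differentiable
    left of [1], and at [1] the modulus of continuity is [e^(1/a)]. *)
Lemma continuous_powR_onem (R : realType) (a : R) : 0 <= a ->
  {within `[-1, 1], continuous (fun y : R => (1 - y) `^ a)}.
Proof.
rewrite le_eqVlt => /orP[/eqP <-|a0].
  under [X in {within _, continuous X}]eq_fun do rewrite powRr0.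
  by apply: continuous_subspaceT => x; exact: cvg_cst.
have ct (x : R) : x < 1 -> {for x, continuous (fun y : R => (1 - y) `^ a)}.
  move=> x1; apply: differentiable_continuous; apply/derivable1_diffP.
  by have [] := is_derive_powR_onem a x1.
apply/continuous_within_itvP; first lra.
split.
- by move=> x; rewrite in_itv /= => /andP[_ x1]; exact: ct.
- by apply: cvg_at_right_filter; apply: ct; lra.
- rewrite subrr powR0 ?gt_eqF //; apply/cvgrPdist_le => e e0; near=> x.
  have x1 : x < 1 by near: x; exact: nbhs_left_lt.
  rewrite sub0r normrN ger0_norm ?powR_ge0 //.
  have d0 : 0 < e `^ a^-1 by exact: powR_gt0.
  have xd : 1 - e `^ a^-1 <= x by near: x; apply: nbhs_left_ge; rewrite gtrBl powR_gt0.
  have eE : e = (e `^ a^-1) `^ a by rewrite -powRrM mulVf ?gt_eqF // powRr1 // ltW.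
  rewrite [leRHS]eE.
  apply: ge0_ler_powR; [exact: ltW | by rewrite nnegrE subr_ge0 ltW | by rewrite nnegrE powR_ge0 |].
  by rewrite lerBlDr -lerBlDl.
Unshelve. all: by end_near.
Qed.

(** [Y] is the integral from [-1]. With this [s], [(s ^+ 2 - (al + be + 1) ^+ 2) / 4] is
    [k * (k + al + be + 1)]. *)
Lemma jacobi_system_jacobiP (R : realType) (k : nat) (al be : R) : 0 <= al -> 0 <= be ->
  exists2 Y : R -> R, jacobi_system al be (2 * k%:R + al + be + 1) (jacobi_poly k al be) (jacobi_weight al be) Y
    & Y 1 - Y (-1) = jacobi_sqnorm k al be.
Proof.
move=> a0 b0.
set p := jacobi_poly k al be; set w := jacobi_weight al be.
have wE : w = (fun y => (1 - y) `^ al) * ((fun y => (1 - y) `^ be) \o -%R).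
  by apply/funext => x; rewrite /w /jacobi_weight !fctE /= opprK.
have wc : {within `[-1, 1], continuous w}.
  rewrite wE; apply: within_continuousM; first exact: continuous_powR_onem.
  by apply: within_continuous_compN; rewrite opprK; exact: continuous_powR_onem.
set f : R -> R := w * horner (p ^+ 2).
have fE x : f x = w x * p.[x] ^+ 2 by rewrite /f !fctE horner_exp.
have fc : {within `[-1, 1], continuous f}.
  by apply: within_continuousM => //; apply: continuous_subspaceT => x; exact: continuous_horner.
have fi : lebesgue_measure.-integrable `[-1, 1] (EFin \o f).
  by apply: continuous_compact_integrable => //; exact: segment_compact.
have m11 : -1 <= 1 :> R by lra.
pose Y x := parameterized_integral lebesgue_measure (-1) x f.
exists Y.
  split => //.
  - move=> x; have := jacobi_poly_ode k al be x => /= <-.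
    by congr (_ + _ * _); field.
  - by move=> x; rewrite mulr_ge0 // powR_ge0.
  - move=> x /andP[x1 x2].
    have D1 := is_derive_powR_onem al x2.
    have DN : is_derive x 1 (-%R : R -> R) (-1) by apply: is_derive_eq.
    have x1' : - x < 1 by lra.
    have D2 := is_derive1_comp (is_derive_powR_onem be x1') DN.
    rewrite wE; apply: (is_derive_eq (is_deriveM D1 D2)).
    rewrite !fctE /= /GRing.scale /= !opprK.
    by field; rewrite !gt_eqF //; lra.
  - exact: parameterized_integral_continuous.
  - move=> x /andP[x1 x2].
    have [|h1 h2] := @continuous_FTC1_closed R f (-1) x 1 x2 fi x1.
      by apply: (within_continuous_continuous _ fc); [lra | rewrite in_itv /= x1].
    by apply: DeriveDef => //; rewrite -derive1E h2 fE.
rewrite /Y /parameterized_integral set_itv1 Rintegral_set1 subr0 /jacobi_sqnorm.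
by apply: eq_Rintegral => x _; rewrite fE horner_jacobi_poly.
Qed.

Theorem theorem1 (R : realType) (k : nat) (al be : R) :
  (1 <= k)%N -> be <= al -> 0 <= be ->
  (exists x : R, delta_m1 k al be <= x <= delta_p1 k al be) /\
  (forall x : R, delta_m1 k al be <= x <= delta_p1 k al be ->
     `|Zfun k al be x| < (5 : R) `^ (- (1 / 4)) * Num.sqrt 3).
Proof.
move=> k1 ba b0; have a0 : 0 <= al by exact: le_trans ba.
have k1R : 1 <= k%:R :> R by rewrite ler1n.
set s := 2 * k%:R + al + be + 1.
set S := Num.sqrt ((2 * k%:R + 1) * (2 * k%:R + 2 * al + 1)
                     * (2 * k%:R + 2 * be + 1) * (2 * k%:R + 2 * al + 2 * be + 1)).
have s0 : 0 < s by rewrite /s; lra.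
have sn : s != 0 by rewrite gt_eqF.
set d := S / s ^+ 2; set c0 := (be ^+ 2 - al ^+ 2) / s ^+ 2.
have d0 : 0 <= d by rewrite divr_ge0 ?sqrtr_ge0 ?sqr_ge0.
(* The four factors under the root are [s - al - be], [s + al - be], [s - al + be] and
   [s + al + be]. *)
have e : (s ^+ 2 * d) ^+ 2 = (s ^+ 2 - (al + be) ^+ 2) * (s ^+ 2 - (al - be) ^+ 2).
  rewrite /d mulrC divfK ?expf_neq0 // sqr_sqrtr; first by rewrite /s; ring.
  by rewrite !mulr_ge0 //; lra.
have dp : delta_p1 k al be = c0 + d by rewrite /delta_p1 /delta_pm -/S -/s /c0 /d -mulrDl.
have dm : delta_m1 k al be = c0 - d by rewrite /delta_m1 /delta_pm -/S -/s /c0 /d -mulrBl.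
rewrite dp dm; split; first by exists c0; apply/andP; split; lra.
move=> x /andP[x1 x2].
set b := 5 `^ _ * _.
have b_gt0 : 0 < b by rewrite mulr_gt0 ?powR_gt0 ?sqrtr_gt0.
have b4 : b ^+ 4 = 9 / 5.
  rewrite /b exprMn -powR_mulrn ?powR_ge0 // -powRrM.
  rewrite (_ : - (1 / 4) * 4%:R = - 1); last by field.
  rewrite powRN powRr1 // (_ : Num.sqrt 3 ^+ 4 = (Num.sqrt 3 ^+ 2) ^+ 2); last by rewrite -exprM.
  by rewrite sqr_sqrtr //; field.
rewrite /Zfun dp dm /jacobiPn.
set I := jacobi_sqnorm k al be.
(* For [I <= 0] the root and its inverse are [0] by convention, so [Zfun] is [0]. *)
have [I0|I0] := lerP I 0.
  by rewrite (ler0_sqrtr I0) invr0 !mulr0 normr0.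
set D := (x - (c0 - d)) * (c0 + d - x).
have DE : D = d ^+ 2 - (x - c0) ^+ 2 by rewrite /D; ring.
(* On the closed interval [D <= 0] occurs only at an endpoint, where [Zfun] vanishes. *)
have [D0|D0] := lerP D 0.
  by rewrite (ler0_sqrtr D0) mul0r sqrtr0 mul0r normr0.
have xin : c0 - d < x < c0 + d.
  have : D != 0 by rewrite gt_eqF.
  rewrite /D mulf_eq0 negb_or !subr_eq0 => /andP[h1 h2].
  by rewrite !lt_neqAle x1 x2 (eq_sym _ x) h1 eq_sym h2.
have [Y js YI] := jacobi_system_jacobiP k a0 b0.
have sab : al + be + 3 <= s by rewrite /s; lra.
have := jacobi_bound js a0 b0 sab d0 e xin; rewrite YI => /(_ I0).
rewrite -/c0 -DE horner_jacobi_poly -/I.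
set w := jacobi_weight al be x; set P := jacobiP k al be x => main.
have w0 : 0 <= w by rewrite mulr_ge0 ?powR_ge0.
(* Fourth powers remove the nested roots and turn the goal into [main] divided by [5 * I ^+ 2]. *)
rewrite -(@ltr_pXn2r _ 4) ?nnegrE ?normr_ge0 ?(ltW b_gt0) //.
rewrite b4 -normrX ger0_norm ?exprn_even_ge0 //.
have -> : (Num.sqrt (Num.sqrt D * w) * (P / Num.sqrt I)) ^+ 4 = D * (w * P ^+ 2) ^+ 2 / I ^+ 2.
  have q1 : Num.sqrt (Num.sqrt D * w) ^+ 4 = D * w ^+ 2.
    have q0 : 0 <= Num.sqrt D * w by rewrite mulr_ge0 ?sqrtr_ge0.
    have -> : Num.sqrt (Num.sqrt D * w) ^+ 4 = (Num.sqrt (Num.sqrt D * w) ^+ 2) ^+ 2 by rewrite -exprM.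
    by rewrite (sqr_sqrtr q0) exprMn (sqr_sqrtr (ltW D0)).
  have q2 : Num.sqrt I ^+ 4 = I ^+ 2 by rewrite -[in RHS](sqr_sqrtr (ltW I0)) -exprM.
  by rewrite exprMn q1 expr_div_n q2; ring.
rewrite ltr_pdivrMr ?exprn_gt0 //; lra.
Qed.
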